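(* Let $n\ge3$ be odd. Let $f:\mathcal{Q}_{\mathbb{R}_n}\to\mathbb{R}_n$ be an entire slice-regular function. If $f$ is bounded on $\mathbb{R}^{n+1}$, then $f$ is constant. If the spherical derivative $f'_s$ is bounded (equivalently, if $\overline\partial f$ is bounded) on $\mathbb{R}^{n+1}$, then $f$ is a left-affine function, of the form $f(x)=a+xb$ with $a,b\in\mathbb{R}_n$.
   Context: $\mathbb{R}_n$ is the real Clifford algebra generated by $e_1,\dots,e_n$ with $e_ie_j+e_je_i=-2\delta_{ij}$; $x\mapsto x^c$ (Clifford conjugation) is the unique linear antiinvolution with $e_i^c=-e_i$. The paravector space $\{x_0+x_1e_1+\cdots+x_ne_n\}\subset\mathbb{R}_n$ is identified with $\mathbb{R}^{n+1}$, and $\overline\partial=\frac{\partial}{\partial x_0}+\sum_{i=1}^ne_i\frac{\partial}{\partial x_i}$ acts on the restriction of $f$ to $\mathbb{R}^{n+1}$. Let $\mathbb{S}_{\mathbb{R}_n}=\{J\in\mathbb{R}_n: J+J^c=0,\ JJ^c=1\}$, $\mathbb{C}_J=\langle 1,J\rangle$, and let $\mathcal{Q}_{\mathbb{R}_n}=\bigcup_{J\in\mathbb{S}_{\mathbb{R}_n}}\mathbb{C}_J$ be the quadratic cone, which contains $\mathbb{R}^{n+1}$. For $x\in\mathcal{Q}_{\mathbb{R}_n}$, $\operatorname{Im}(x)=\frac{x-x^c}{2}$. A stem function on $\mathbb{C}$ is a map $F=F_1+\imath F_2:\mathbb{C}\to\mathbb{R}_n\otimes_{\mathbb{R}}\mathbb{C}$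 ($F_1,F_2$ being $\mathbb{R}_n$-valued, $\imath^2=-1$) with $F(\overline z)=\overline{F(z)}$, where $\overline{a+\imath b}=a-\imath b$. It induces the (left) slice function $f=\mathcal{I}(F):\mathcal{Q}_{\mathbb{R}_n}\to\mathbb{R}_n$, $f(\alpha+J\beta)=F_1(\alpha+i\beta)+JF_2(\alpha+i\beta)$ ($\alpha,\beta\in\mathbb{R}$, $J\in\mathbb{S}_{\mathbb{R}_n}$). An entire slice-regular function on $\mathcal{Q}_{\mathbb{R}_n}$ is such an $f$ with $F$ holomorphic on $\mathbb{C}$ (with respect to the complex structure given by $\imath$). The spherical derivative of $f$ is $f'_s(x)=\frac12\operatorname{Im}(x)^{-1}(f(x)-f(x^c))$ for $x\notin\mathbb{R}$; for $f$ slice-regular it extends continuously to real points. *)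

(* Defs.v *)
From HB Require Import structures.
From mathcomp Require Import all_boot all_order all_algebra all_field complex.
From mathcomp Require Import all_classical all_reals all_analysis.

Set Implicit Arguments.
Unset Strict Implicit.
Unset Printing Implicit Defensive.

Import Order.TTheory GRing.Theory Num.Theory.
Import numFieldNormedType.Exports.

Local Open Scope classical_set_scope.
Local Open Scope ring_scope.

(* The Clifford algebra on n generators of square -1 over K, as the free
   K-module on the blades e_A, for A a subset of 'I_n: e_A is the product of
   the e_i, i in A, in increasing order.  As a module with norm and topology
   it is a space of row vectors (sup norm of the coordinates). *)
Definition clifford (K : Type) (n : nat) : Type := 'rV[K]_#|{set 'I_n}|.

HB.instance Definition _ (K : comNzRingType) n :=
  GRing.Lmodule.copy (clifford K n) 'rV[K]_#|{set 'I_n}|.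

Section CliffordAlgebra.
Variables (K : comNzRingType) (n : nat).
Implicit Types (A B C : {set 'I_n}) (x y z : clifford K n).

Definition blade A : clifford K n := delta_mx 0 (enum_rank A).

Definition coef x A : K := x 0 (enum_rank A).

Definition symdiff A B := (A :\: B) :|: (B :\: A).

(* e_A e_B = blade_sign A B *: e_(A symdiff B): sorting the factors costs one
   sign for each pair (i, j) in A x B with j < i, and each common factor
   contributes e_i ^+ 2 = -1, whence the pairs with j = i. *)
Definition blade_sign A B : K :=
  (-1) ^+ #|[pred p : 'I_n * 'I_n | [&& p.1 \in A, p.2 \in B & (p.2 <= p.1)%N]]|.

Definition clifford_mul x y : clifford K n :=
  \sum_A \sum_B
    (coef x A * coef y B * blade_sign A B) *: blade (symdiff A B).

Lemma in_symdiff i A B : (i \in symdiff A B) = (i \in A) (+) (i \in B).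
Proof. by rewrite /symdiff !finset.inE; case: (i \in A); case: (i \in B). Qed.

Lemma symdiffA A B C : symdiff A (symdiff B C) = symdiff (symdiff A B) C.
Proof. by apply/setP => i; rewrite !in_symdiff addbA. Qed.

Lemma symdiffC A B : symdiff A B = symdiff B A.
Proof. by apply/setP => i; rewrite !in_symdiff addbC. Qed.

Lemma symdiff0s A : symdiff finset.set0 A = A.
Proof. by apply/setP => i; rewrite in_symdiff finset.inE. Qed.

Lemma blade_signE A B :
  blade_sign A B = \prod_(p : 'I_n * 'I_n)
    (-1) ^+ [&& p.1 \in A, p.2 \in B & (p.2 <= p.1)%N].
Proof.
rewrite /blade_sign -prodr_const big_mkcond; apply: eq_bigr => p _.
by rewrite unfold_in; case: ifP.
Qed.

Lemma blade_signDl A B C :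
  blade_sign (symdiff A B) C = blade_sign A C * blade_sign B C.
Proof.
rewrite !blade_signE -big_split; apply: eq_bigr => p _ /=.
rewrite in_symdiff -signr_addb; congr (_ ^+ _).
by case: (p.1 \in A) (p.1 \in B) (p.2 \in C) (_ <= _)%N => [] [] [] [].
Qed.

Lemma blade_signDr A B C :
  blade_sign A (symdiff B C) = blade_sign A B * blade_sign A C.
Proof.
rewrite !blade_signE -big_split; apply: eq_bigr => p _ /=.
rewrite in_symdiff -signr_addb; congr (_ ^+ _).
by case: (p.1 \in A) (p.2 \in B) (p.2 \in C) (_ <= _)%N => [] [] [] [].
Qed.

Lemma blade_sign_sqr A B : blade_sign A B * blade_sign A B = 1.
Proof. by rewrite /blade_sign -expr2 sqrr_sign. Qed.

Lemma blade_sign0l A : blade_sign finset.set0 A = 1.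
Proof. by rewrite blade_signE big1 // => p _; rewrite finset.inE. Qed.

Lemma blade_sign0r A : blade_sign A finset.set0 = 1.
Proof. by rewrite blade_signE big1 // => p _; rewrite finset.inE andbF. Qed.

Lemma coef_blade A B : coef (blade A) B = (B == A)%:R.
Proof. by rewrite /coef mxE (inj_eq enum_rank_inj). Qed.

Lemma coefD x y A : coef (x + y) A = coef x A + coef y A.
Proof. by rewrite /coef mxE. Qed.

Lemma coefZ a x A : coef (a *: x) A = a * coef x A.
Proof. by rewrite /coef mxE. Qed.

Lemma clifford_sumE x : x = \sum_A coef x A *: blade A.
Proof.
rewrite [LHS]row_sum_delta (reindex_onto enum_rank enum_val) /=; last first.
  by move=> i _; rewrite enum_valK.
by apply: eq_bigl => A; rewrite enum_rankK eqxx.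
Qed.

Lemma clifford_mulDl : left_distributive clifford_mul +%R.
Proof.
move=> x y z; rewrite /clifford_mul -big_split; apply: eq_bigr => A _.
rewrite -big_split; apply: eq_bigr => B _ /=.
by rewrite coefD !mulrDl scalerDl.
Qed.

Lemma clifford_mulDr : right_distributive clifford_mul +%R.
Proof.
move=> x y z; rewrite /clifford_mul -big_split; apply: eq_bigr => A _.
rewrite -big_split; apply: eq_bigr => B _ /=.
by rewrite coefD mulrDr mulrDl scalerDl.
Qed.

Lemma clifford_scalerAl a x y :
  a *: clifford_mul x y = clifford_mul (a *: x) y.
Proof.
rewrite /clifford_mul scaler_sumr; apply: eq_bigr => A _.
rewrite scaler_sumr; apply: eq_bigr => B _.
by rewrite coefZ scalerA !mulrA.
Qed.

Lemma clifford_scalerAr a x y :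
  a *: clifford_mul x y = clifford_mul x (a *: y).
Proof.
rewrite /clifford_mul scaler_sumr; apply: eq_bigr => A _.
rewrite scaler_sumr; apply: eq_bigr => B _.
by rewrite coefZ scalerA !mulrA [coef x A * a]mulrC.
Qed.

Lemma clifford_mul_blade A B :
  clifford_mul (blade A) (blade B) = blade_sign A B *: blade (symdiff A B).
Proof.
rewrite /clifford_mul (bigD1 A) //= [X in _ + X]big1 ?addr0; last first.
  move=> A' A'A; rewrite big1 // => B' _.
  by rewrite coef_blade (negPf A'A) !mul0r scale0r.
rewrite (bigD1 B) //= big1 ?addr0; last first.
  by move=> B' B'B; rewrite !coef_blade (negPf B'B) mulr0 mul0r scale0r.
by rewrite !coef_blade !eqxx !mul1r.
Qed.

Lemma clifford_blade_ind (P : clifford K n -> Prop) :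
  (forall a x y, P x -> P y -> P (a *: x + y)) -> (forall A, P (blade A)) ->
  forall x, P x.
Proof.
move=> PD Pb x; have P0 : P 0.
  by rewrite -(addNr (blade finset.set0)) -scaleN1r; apply: PD.
rewrite [x]clifford_sumE; elim: (index_enum _) => [|A s IHs].
  by rewrite big_nil.
by rewrite big_cons; apply: PD.
Qed.

Lemma clifford_mulPl a x y z :
  clifford_mul (a *: x + y) z = a *: clifford_mul x z + clifford_mul y z.
Proof. by rewrite clifford_mulDl clifford_scalerAl. Qed.

Lemma clifford_mulPr a x y z :
  clifford_mul z (a *: x + y) = a *: clifford_mul z x + clifford_mul z y.
Proof. by rewrite clifford_mulDr clifford_scalerAr. Qed.

Lemma clifford_mulA : associative clifford_mul.
Proof.
elim/clifford_blade_ind => [a x x' IHx IHx' y z|A].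
  by rewrite !clifford_mulPl IHx IHx'.
elim/clifford_blade_ind => [a y y' IHy IHy' z|B].
  by rewrite clifford_mulPl !clifford_mulPr clifford_mulPl IHy IHy'.
elim/clifford_blade_ind => [a z z' IHz IHz'|C].
  by rewrite !clifford_mulPr IHz IHz'.
rewrite !clifford_mul_blade -clifford_scalerAr -clifford_scalerAl.
rewrite !clifford_mul_blade symdiffA !scalerA; congr (_ *: _).
by rewrite blade_signDl blade_signDr mulrC mulrA.
Qed.

Lemma clifford_mul1l : left_id (blade finset.set0) clifford_mul.
Proof.
elim/clifford_blade_ind => [a x y IHx IHy|A].
  by rewrite clifford_mulPr IHx IHy.
by rewrite clifford_mul_blade blade_sign0l scale1r symdiff0s.
Qed.

Lemma clifford_mul1r : right_id (blade finset.set0) clifford_mul.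
Proof.
elim/clifford_blade_ind => [a x y IHx IHy|A].
  by rewrite clifford_mulPl IHx IHy.
by rewrite clifford_mul_blade blade_sign0r scale1r symdiffC symdiff0s.
Qed.

Lemma blade0_neq0 : blade finset.set0 != 0.
Proof.
apply/eqP => /(congr1 (coef^~ finset.set0)); rewrite coef_blade eqxx /coef mxE.
by apply/eqP; rewrite oner_neq0.
Qed.

End CliffordAlgebra.

HB.instance Definition _ (K : comNzRingType) n :=
  GRing.Zmodule_isNzRing.Build (clifford K n)
    (@clifford_mulA K n) (@clifford_mul1l K n) (@clifford_mul1r K n)
    (@clifford_mulDl K n) (@clifford_mulDr K n) (@blade0_neq0 K n).

HB.instance Definition _ (K : comNzRingType) n :=
  GRing.Lmodule_isLalgebra.Build K (clifford K n) (@clifford_scalerAl K n).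

HB.instance Definition _ (K : comNzRingType) n :=
  GRing.Lalgebra_isAlgebra.Build K (clifford K n) (@clifford_scalerAr K n).

HB.instance Definition _ (K : fieldType) n :=
  Vector.copy (clifford K n) 'rV[K]_#|{set 'I_n}|.

(* provides the inverse x^-1 of the invertible elements of the algebra *)
HB.instance Definition _ (K : fieldType) n :=
  Algebra_isFalgebra.Build K (clifford K n).

HB.instance Definition _ (K : numFieldType) n :=
  NormedModule.copy (clifford K n) 'rV[K]_#|{set 'I_n}|.

Section CliffordConjugation.
Variables (K : comNzRingType) (n : nat).
Implicit Types (i j : 'I_n) (A B : {set 'I_n}) (x y : clifford K n).

Definition clifford_gen i : clifford K n := blade K (finset.set1 i).

(* Reversing the |A| factors of e_A costs (-1) ^ (|A| (|A| - 1) / 2), and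
   changing the sign of each of them (-1) ^ |A|. *)
Definition clifford_conj x : clifford K n :=
  \sum_(A : {set 'I_n}) ((-1) ^+ 'C(#|A|.+1, 2) * coef x A) *: blade K A.

Lemma blade_mul A B :
  blade K A * blade K B = blade_sign K A B *: blade K (symdiff A B).
Proof. exact: clifford_mul_blade. Qed.

Lemma blade_set0 : blade K (@finset.set0 'I_n) = 1.
Proof. by []. Qed.

Lemma blade_sign1l i A :
  blade_sign K (finset.set1 i) A =
  \prod_(j : 'I_n) (-1) ^+ ((j \in A) && (j <= i)%N).
Proof.
rewrite blade_signE -(pair_bigA _ (fun k j : 'I_n =>
  (-1) ^+ [&& k \in finset.set1 i, j \in A & (j <= k)%N])) /= (bigD1 i) //=.
rewrite [X in _ * X]big1 ?mulr1 => [|k ki].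
  by apply: eq_bigr => j _; rewrite finset.in_set1 eqxx.
by rewrite big1 // => j _; rewrite finset.in_set1 (negPf ki).
Qed.

Lemma blade_sign1r i A :
  blade_sign K A (finset.set1 i) =
  \prod_(j : 'I_n) (-1) ^+ ((j \in A) && (i <= j)%N).
Proof.
rewrite blade_signE -(pair_bigA _ (fun j k : 'I_n =>
  (-1) ^+ [&& j \in A, k \in finset.set1 i & (k <= j)%N])) /=.
apply: eq_bigr => j _; rewrite (bigD1 i) //= big1 ?mulr1 => [|k ki].
  by rewrite finset.in_set1 eqxx.
by rewrite finset.in_set1 (negPf ki) andbF.
Qed.

Lemma blade_sign11 i : blade_sign K (finset.set1 i) (finset.set1 i) = -1.
Proof.
rewrite blade_sign1l (bigD1 i) //= big1 ?mulr1 => [|j ji].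
  by rewrite finset.in_set1 eqxx leqnn.
by rewrite finset.in_set1 (negPf ji).
Qed.

Lemma blade_sign1_comm i A : i \notin A ->
  blade_sign K (finset.set1 i) A * blade_sign K A (finset.set1 i) =
  (-1) ^+ #|A|.
Proof.
move=> iA; rewrite blade_sign1l blade_sign1r -big_split /= -prodr_const.
rewrite [RHS]big_mkcond; apply: eq_bigr => j _.
case: ifP => [jA|_]; rewrite /= ?mulr1 //.
case: (ltngtP j i) => [||/val_inj ji]; rewrite ?mulr1 ?mul1r //.
by move: jA; rewrite ji (negPf iA).
Qed.

Lemma blade_sign_diag A : blade_sign K A A = (-1) ^+ 'C(#|A|.+1, 2).
Proof.
move: {2}#|A| (erefl #|A|) => k; elim: k A => [|k IHk] A cA.
  by have -> := cards0_eq cA; rewrite blade_sign0l finset.cards0.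
have [i iA] : exists i, i \in A by apply/card_gt0P; rewrite cA.
have AE : A = symdiff (finset.set1 i) (A :\ i).
  apply/setP => j; rewrite in_symdiff finset.in_setD1 finset.in_set1.
  by case: eqVneq => [->|//]; rewrite iA.
have iA' : i \notin A :\ i by rewrite finset.in_setD1 eqxx.
have cA' : #|A :\ i| = k.
  by move: cA; rewrite (finset.cardsD1 i) iA => -[].
rewrite cA [in LHS]AE blade_signDl !blade_signDr blade_sign11 IHk // cA'.
rewrite mulrA -[_ * _ * blade_sign K _ _]mulrA blade_sign1_comm // cA'.
by rewrite -exprS -exprD [in RHS]binS bin1 addnC.
Qed.

Lemma coef_conj x A :
  coef (clifford_conj x) A = (-1) ^+ 'C(#|A|.+1, 2) * coef x A.
Proof.
rewrite /coef summxE (bigD1 A) //= big1 ?addr0 => [|B BA].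
  by rewrite !mxE !eqxx mulr1.
by rewrite !mxE (inj_eq enum_rank_inj) eq_sym (negPf BA) andbF mulr0.
Qed.

Lemma clifford_ext x y : (forall A, coef x A = coef y A) -> x = y.
Proof.
by move=> xy; apply/rowP => i; rewrite -(enum_valK i); apply: xy.
Qed.

Lemma clifford_conj_is_linear : linear clifford_conj.
Proof.
move=> a x y; apply: clifford_ext => A; rewrite coef_conj !coefD !coefZ.
by rewrite !coef_conj mulrDr mulrCA.
Qed.

HB.instance Definition _ := GRing.isLinear.Build K (clifford K n)
  (clifford K n) *:%R clifford_conj clifford_conj_is_linear.

Lemma clifford_conj_blade A :
  clifford_conj (blade K A) = blade_sign K A A *: blade K A.
Proof.
apply: clifford_ext => B; rewrite coef_conj coefZ coef_blade blade_sign_diag.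
by case: eqVneq => [->//|_]; rewrite !mulr0.
Qed.

Lemma clifford_conjK : involutive clifford_conj.
Proof.
move=> x; apply: clifford_ext => A.
by rewrite !coef_conj mulrA -expr2 sqrr_sign mul1r.
Qed.

Lemma clifford_conjM x y :
  clifford_conj (x * y) = clifford_conj y * clifford_conj x.
Proof.
elim/clifford_blade_ind: x => [a x x' IHx IHx'|A].
  by rewrite mulrDl -scalerAl !linearP /= IHx IHx' mulrDr scalerAr.
elim/clifford_blade_ind: y => [a y y' IHy IHy'|B].
  by rewrite mulrDr -scalerAr !linearP /= IHy IHy' mulrDl scalerAl.
rewrite blade_mul linearZ /= !clifford_conj_blade -scalerAl -scalerAr.
rewrite blade_mul !scalerA (symdiffC A B); congr (_ *: _).
rewrite blade_signDl !blade_signDr; set ab := blade_sign K A B.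
set ba := blade_sign K B A; have ab2 : ab * ab = 1 by exact: blade_sign_sqr.
by rewrite mulrA [ab * _]mulrCA mulrA -[_ * ab * ab]mulrA ab2 mulr1 mulrAC.
Qed.

Lemma clifford_conj_gen i : clifford_conj (clifford_gen i) = - clifford_gen i.
Proof. by rewrite clifford_conj_blade blade_sign11 scaleN1r. Qed.

Lemma clifford_gen_rel i j :
  clifford_gen i * clifford_gen j + clifford_gen j * clifford_gen i =
  (- 2 * (i == j)%:R)%:A.
Proof.
rewrite !blade_mul (symdiffC (finset.set1 j)) -scalerDl.
have [<-|ij] := eqVneq i j.
  rewrite blade_sign11 /= mulr1 -opprD; congr (_ *: _); rewrite -blade_set0.
  by congr blade; apply/setP => k; rewrite in_symdiff addbb finset.inE.
have ij' : i \notin finset.set1 j by rewrite finset.in_set1.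
have := blade_sign1_comm ij'; rewrite finset.cards1 expr1 => h.
have := blade_sign_sqr K (finset.set1 j) (finset.set1 i).
set a := blade_sign _ _ _ in h *; set b := blade_sign _ _ _ in h * => bb.
suff -> : a + b = 0 by rewrite mulr0 !scale0r.
by rewrite -[a]mulr1 -bb mulrA h mulN1r addNr.
Qed.

(* the generators and 1 generate the algebra *)
Lemma clifford_gen_ind (P : clifford K n -> Prop) :
  P 1 -> (forall a x y, P x -> P y -> P (a *: x + y)) ->
  (forall i x, P x -> P (clifford_gen i * x)) -> forall x, P x.
Proof.
move=> P1 PD PM; have P0 : P 0 by rewrite -(addNr 1) -scaleN1r; apply: PD.
apply: clifford_blade_ind => // A.
move: {2}#|A| (erefl #|A|) => k; elim: k A => [|k IHk] A cA.
  by have -> := cards0_eq cA; rewrite blade_set0.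
have [i iA] : exists i, i \in A by apply/card_gt0P; rewrite cA.
have AE : A = symdiff (finset.set1 i) (A :\ i).
  apply/setP => j; rewrite in_symdiff finset.in_setD1 finset.in_set1.
  by case: eqVneq => [->|//]; rewrite iA.
have cA' : #|A :\ i| = k.
  by move: cA; rewrite (finset.cardsD1 i) iA => -[].
set s := blade_sign K (finset.set1 i) (A :\ i).
have -> : blade K A = s *: (clifford_gen i * blade K (A :\ i)) + 0.
  by rewrite blade_mul scalerA blade_sign_sqr scale1r addr0 -AE.
by apply: PD => //; apply/PM/IHk.
Qed.

Lemma clifford_conj_unique (phi : {linear clifford K n -> clifford K n}) :
  involutive phi -> (forall x y, phi (x * y) = phi y * phi x) ->
  (forall i, phi (clifford_gen i) = - clifford_gen i) ->
  phi =1 clifford_conj.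
Proof.
move=> phiK phiM phi_gen; have conj1 : clifford_conj 1 = 1.
  by rewrite clifford_conj_blade blade_sign0l scale1r.
have phi1 : phi 1 = 1.
  by rewrite -[LHS]mulr1 -[X in _ * X]phiK -phiM mulr1 phiK.
elim/clifford_gen_ind => [|a x y IHx IHy|i x IHx].
- by rewrite phi1 conj1.
- by rewrite !linearP IHx IHy.
- by rewrite phiM clifford_conjM IHx phi_gen clifford_conj_gen.
Qed.

End CliffordConjugation.

Section SliceRegular.
Variables (R : realType) (n : nat).
Implicit Types (f : clifford R n -> clifford R n) (x J : clifford R n).

(* R ^ (n + 1) *)
Definition paravectors : set (clifford R n) :=
  [set x | exists (x0 : R) (v : 'I_n -> R),
     x = x0%:A + \sum_i v i *: clifford_gen R i].

Definition real_points : set (clifford R n) :=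
  [set x | exists a : R, x = a%:A].

Definition imaginary_units : set (clifford R n) :=
  [set J | J + clifford_conj J = 0 /\ J * clifford_conj J = 1].

Definition quadratic_cone : set (clifford R n) :=
  [set x | exists2 J, imaginary_units J &
     exists a b : R, x = a%:A + b *: J].

Definition clifford_Im x : clifford R n := 2^-1 *: (x - clifford_conj x).

(* The complexification of R_n is the Clifford algebra over R[i], that is
   row vectors over R[i]; a + ib has coordinates a_A + i b_A. *)
Definition stem1 (F : R[i] -> clifford R[i] n) (z : R[i]) : clifford R n :=
  map_mx (@complex.Re R) (F z).

Definition stem2 (F : R[i] -> clifford R[i] n) (z : R[i]) : clifford R n :=
  map_mx (@complex.Im R) (F z).

Definition stem_function (F : R[i] -> clifford R[i] n) : Prop :=
  forall z : R[i], F (conjc z) = map_mx (@conjc R) (F z).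

(* complex differentiability everywhere, R[i]^o being R[i] seen as a normed
   space over itself *)
Definition entire_stem (F : R[i] -> clifford R[i] n) : Prop :=
  forall z : R[i], derivable (F : R[i]^o -> clifford R[i] n) z 1.

(* Functions on the quadratic cone are represented by total functions, whose
   values outside of the cone are irrelevant. *)
Definition slice_function_of (F : R[i] -> clifford R[i] n) f : Prop :=
  forall J (a b : R), imaginary_units J ->
    f (a%:A + b *: J) =
    stem1 F (Complex a b) + J * stem2 F (Complex a b).

Definition entire_slice_regular f : Prop :=
  exists F : R[i] -> clifford R[i] n,
    [/\ stem_function F, entire_stem F & slice_function_of F f].

Definition spherical_quotient f x : clifford R n :=
  2^-1 *: ((clifford_Im x)^-1 * (f x - f (clifford_conj x))).

(* at real points, the value of the continuous extension *)
Definition spherical_derivative f x : clifford R n :=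
  if `[< real_points x >] then
    lim (spherical_quotient f y @[y -->
           within (quadratic_cone `\` real_points) (nbhs x)])
  else spherical_quotient f x.

(* At a paravector, this only depends on the restriction of f to paravectors. *)
Definition dbar f x : clifford R n :=
  'D_1 f x + \sum_i clifford_gen R i * 'D_(clifford_gen R i) f x.

End SliceRegular.

Arguments paravectors R n : clear implicits.
Arguments quadratic_cone R n : clear implicits.

(* Main.v *)
Require Import Defs.
From HB Require Import structures.
From mathcomp Require Import all_boot all_order all_algebra all_field complex.
From mathcomp Require Import all_classical all_reals all_analysis.
From mathcomp Require Import ring lra.

Set Implicit Arguments.
Unset Strict Implicit.
Unset Printing Implicit Defensive.

Import Order.TTheory GRing.Theory Num.Theory.
Import numFieldNormedType.Exports.

Local Open Scope classical_set_scope.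
Local Open Scope ring_scope.

(** The stem function F = F_1 + i F_2 of an entire slice-regular function has
    2^n coordinates, each of which is an entire function of one complex
    variable, and the theorem is a growth statement about these coordinates.

    Let e be a generator.  The paravectors a + b e lie in a single complex
    plane, on which f = F_1 + e F_2.  A bound on f over the paravectors
    therefore bounds f at a + b e and at a - b e, hence F_2 (a + i b), by a
    constant.  The spherical derivative at a + b e is F_2 (a + i b) / b, so a
    bound on it gives |F_2 (a + i b)| <= C |b|.  Finally dbar f is
    (1 - n) F_2 (a + i b) / b (lemma dbar_gen_plane): the derivatives along 1
    and e cancel by the Cauchy-Riemann equations, and each of the n - 1 other
    generators is orthogonal to the plane, so that it moves the point to first
    order by rotating the imaginary unit e.  A bound on dbar f thus amounts to
    the same growth of F_2.

    In each case the imaginary parts of the coordinates satisfy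
    |Im (G z)| <= C (1 + |Im z|), and a Liouville theorem
    (entire_Im_linear_growth) shows that G is affine.  The symmetry
    F (conj z) = conj (F z) makes its coefficients real, and f x = a + x b
    follows on the whole cone; b = 0 if f is bounded.  Conversely, for affine f
    both the spherical derivative and dbar f are constant on the paravectors,
    which closes the circle and gives the equivalence.

    The Liouville theorem rests on the integral theorem of Cauchy and Goursat
    for rectangles (goursat), applied in logarithmic polar coordinates.  If G
    is entire, then w |-> G (z0 + exp w) exp (- w) and
    w |-> G (z0 + exp w) exp w are entire and 2 pi i-periodic, so that their
    integrals over vertical segments of length 2 pi do not depend on the
    segment.  Comparing with the limit Re w -> -oo expresses G' (z0) by the
    first Fourier coefficient of Im G on any circle around z0
    (Im_derive_bound): |Re (G' z0)| and |Im (G' z0)| are at most 2 / r times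
    the maximum of |Im G| on the circle of radius r.  For Im G of linear growth
    this bounds G'; then z |-> G (z + v) - G z has bounded imaginary part, and
    the same estimate shows that its derivative vanishes, so G' is constant. *)

(** * Integrals of continuous functions over segments *)
Section Segment.
Variable R : realType.
Implicit Types (f g F : R -> R) (a b c : R).

Definition segment_int f a b : R := (\int[lebesgue_measure]_(x in `[a, b]) f x)%R.

Lemma segment_int_integrable f a b : continuous f ->
  (@lebesgue_measure R).-integrable `[a, b] (EFin \o f).
Proof.
move=> cf; apply: continuous_compact_integrable; first exact: segment_compact.
exact: continuous_subspaceT.
Qed.

Lemma segment_intD f g a b : continuous f -> continuous g ->
  segment_int (fun x => f x + g x) a b = segment_int f a b + segment_int g a b.
Proof.
by move=> cf cg; rewrite /segment_int RintegralD//; exact: segment_int_integrable.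
Qed.

Lemma segment_intB f g a b : continuous f -> continuous g ->
  segment_int (fun x => f x - g x) a b = segment_int f a b - segment_int g a b.
Proof.
by move=> cf cg; rewrite /segment_int RintegralB//; exact: segment_int_integrable.
Qed.

Lemma segment_intZ k f a b : continuous f ->
  segment_int (fun x => k * f x) a b = k * segment_int f a b.
Proof.
by move=> cf; rewrite /segment_int RintegralZl//; exact: segment_int_integrable.
Qed.

Lemma segment_int_split f a b c : continuous f -> a <= b -> b <= c ->
  segment_int f a c = segment_int f a b + segment_int f b c.
Proof.
move=> cf ab bc; apply/eqP; rewrite addrC -subr_eq; apply/eqP.
rewrite /segment_int Rintegral_itvB ?bnd_simp//; last exact: segment_int_integrable.
rewrite Rintegral_itv_obnd_cbnd//.
apply: (integrableS _ _ _ (segment_int_integrable b c cf)) => //.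
by move=> x/=; rewrite !in_itv/= => /andP[/ltW -> ->].
Qed.

Lemma segment_int_cst k a b : a <= b -> segment_int (fun=> k) a b = k * (b - a).
Proof.
move=> ab; rewrite /segment_int Rintegral_cst//= lebesgue_measure_itv/= lte_fin.
have [ab'|] := ltP a b; first by [].
move=> ba; have -> : a = b by apply/eqP; rewrite eq_le ab.
by rewrite subrr.
Qed.

Lemma segment_int_near_cst f k M a b : continuous f -> a <= b ->
  (forall x, a <= x <= b -> `|f x - k| <= M) ->
  `|segment_int f a b - k * (b - a)| <= M * (b - a).
Proof.
move=> cf ab fM; have cfk : continuous (fun x => f x - k).
  by move=> x; apply: continuousB; [exact: cf|exact: cst_continuous].
rewrite -segment_int_cst// -segment_intB//; last exact: cst_continuous.
rewrite /segment_int; apply: (le_trans (le_normr_Rintegral _ _)) => //.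
  exact: (segment_int_integrable a b cfk).
rewrite -segment_int_cst// /segment_int; apply: le_Rintegral => //.
- apply: (@segment_int_integrable (fun x => `|f x - k|)) => x.
  exact: cvg_norm (cfk x).
by apply: (@segment_int_integrable (fun=> M)) => x; exact: cst_continuous.
Qed.

Lemma segment_int_bound f M a b : continuous f -> a <= b ->
  (forall x, a <= x <= b -> `|f x| <= M) -> `|segment_int f a b| <= M * (b - a).
Proof.
move=> cf ab fM; have := @segment_int_near_cst f 0 M a b cf ab.
by rewrite mul0r subr0; apply => x /fM; rewrite subr0.
Qed.

Lemma segment_int_FTC f F a b : a < b -> continuous f ->
  (forall x : R, is_derive x 1 F (f x)) -> segment_int f a b = F b - F a.
Proof.
move=> ab cf dF; rewrite /segment_int /Rintegral.
have cF : continuous F.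
  by move=> x; apply/differentiable_continuous/derivable1_diffP; exact: ex_derive.
rewrite (@continuous_FTC2 _ f F)//.
- exact: continuous_subspaceT.
- split; first by move=> x _; exact: ex_derive.
  + exact/cvg_at_right_filter/cF.
  + exact/cvg_at_left_filter/cF.
- by move=> x _; rewrite derive1E derive_val.
Qed.

End Segment.

(** * Bisection of rectangles *)
Section Bisection.
Variable R : realType.

Lemma nested_segments (u l : nat -> R) : (forall k, 0 <= l k) ->
  (forall k, u k <= u k.+1) -> (forall k, u k.+1 + l k.+1 <= u k + l k) ->
  exists x, forall k, u k <= x <= u k + l k.
Proof.
move=> l0 u_inc ul_dec.
have u_mono : {homo u : k m / (k <= m)%N >-> k <= m}.
  exact: homo_leq lexx le_trans u_inc.
have ul_mono : {homo (fun k => u k + l k) : k m / (k <= m)%N >-> k >= m}.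
  by apply: homo_leq => [k|x y z /[swap] yx|k]; [exact: lexx|exact: le_trans|].
have u_ul k m : u k <= u m + l m.
  have [km|/ltnW mk] := leqP k m.
    by rewrite (le_trans (u_mono _ _ km))// lerDl.
  by rewrite (le_trans _ (ul_mono _ _ mk))// lerDl.
exists (sup (range u)) => k; apply/andP; split.
  apply: ub_le_sup; last by exists k.
  by exists (u 0 + l 0) => _ [m _ <-]; exact: u_ul.
apply: ge_sup; first by exists (u 0), 0%N.
by move=> _ [m _ <-]; exact: u_ul.
Qed.

(** Additivity forces one of the four quarters of a rectangle to carry at least
    a quarter of |W|, so the repeatedly chosen quarters satisfy
    |W| > e0 / 4 ^ k for a fixed e0 > 0.  They shrink to a point, near which
    the last hypothesis makes |W| quadratically small with any constant, which
    contradicts this lower bound. *)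
Lemma rectangle_bisection (W : R -> R -> R -> R -> R) :
  (forall a c w h, 0 < w -> 0 < h ->
     W a c w h = W a c (w / 2) h + W (a + w / 2) c (w / 2) h) ->
  (forall a c w h, 0 < w -> 0 < h ->
     W a c w h = W a c w (h / 2) + W a (c + h / 2) w (h / 2)) ->
  (forall x y e, 0 < e -> exists2 d, 0 < d & forall a c w h,
     0 < w < d -> 0 < h < d -> a <= x <= a + w -> c <= y <= c + h ->
     `|W a c w h| <= e * (w + h) ^+ 2) ->
  forall a c w h, 0 < w -> 0 < h -> W a c w h = 0.
Proof.
move=> Wx Wy Wloc a c w h w0 h0; apply/eqP/negP => /negP W0.
have tri4 (x1 x2 x3 x4 : R) :
    `|x1 + x2 + (x3 + x4)| <= `|x1| + `|x2| + (`|x3| + `|x4|).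
  by rewrite (le_trans (ler_normD _ _))// lerD// ler_normD.
pose q k : R := 2^-1 ^+ k.
have q0 k : 0 < q k by rewrite exprn_gt0// invr_gt0.
have qS k : q k.+1 = q k / 2 by rewrite /q exprSr.
(* half of |W|, so that the strict inequality of bad holds at level 0 *)
pose e0 := `|W a c w h| / 2.
have e0_gt0 : 0 < e0 by rewrite divr_gt0// normr_gt0.
pose bad k (p : R * R) :=
  e0 * q k ^+ 2 < `|W p.1 p.2 (w * q k) (h * q k)|.
pose inside k (p p' : R * R) :=
  (p.1 <= p'.1 /\ p'.1 + w * q k.+1 <= p.1 + w * q k) /\
  (p.2 <= p'.2 /\ p'.2 + h * q k.+1 <= p.2 + h * q k).
have step k p : bad k p -> exists p', inside k p p' /\ bad k.+1 p'.
  move=> bp; apply: contrapT => /forallNP good.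
  have small p' : inside k p p' ->
      `|W p'.1 p'.2 (w * q k / 2) (h * q k / 2)| <= e0 * q k ^+ 2 / 4.
    move=> ip'; have := good p'; rewrite not_andP => -[//|/negP].
    rewrite /bad qS -leNgt !mulrA => /le_trans; apply.
    by rewrite le_eqVlt; apply/orP; left; apply/eqP; field.
  have wk : 0 < w * q k by rewrite mulr_gt0.
  have hk : 0 < h * q k by rewrite mulr_gt0.
  have := small (p.1, p.2); have := small (p.1 + w * q k / 2, p.2).
  have := small (p.1, p.2 + h * q k / 2).
  have := small (p.1 + w * q k / 2, p.2 + h * q k / 2).
  rewrite /inside/= qS !mulrA => s1 s2 s3 s4.
  have {}s1 := s1 ltac:(lra); have {}s2 := s2 ltac:(lra).
  have {}s3 := s3 ltac:(lra); have {}s4 := s4 ltac:(lra).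
  move: bp; rewrite /bad Wx// Wy ?divr_gt0// (Wy (_ + _)) ?divr_gt0//.
  apply/negP; rewrite -leNgt.
  apply: (le_trans (tri4 _ _ _ _)).
  move: s1 s2 s3 s4; rewrite !mulrA; lra.
have [|nxt Hnxt] := @choice (nat * (R * R))%type (R * R)%type (fun kp p' =>
    bad kp.1 kp.2 -> inside kp.1 kp.2 p' /\ bad kp.1.+1 p').
  move => -[k p] /=.
  have [bp|nbp] := pselect (bad k p); last by exists p.
  by have [p' hp'] := step k p bp; exists p'.
pose s := fix s k := if k is k'.+1 then nxt (k', s k') else (a, c).
have bad_s k : bad k (s k).
  elim: k => [|k IHk]; last by have [] := Hnxt (k, s k) IHk.
  rewrite /bad /= /q expr0 !mulr1 expr1n mulr1 /e0.
  by rewrite ltr_pdivrMr// ltr_pMr ?normr_gt0// ltr1n.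
have in_s k : inside k (s k) (s k.+1) by have [] := Hnxt (k, s k) (bad_s k).
have [x xP] : exists x, forall k, (s k).1 <= x <= (s k).1 + w * q k.
  apply: nested_segments => k; first by rewrite ltW// mulr_gt0.
    by have [[]] := in_s k.
  by have [[]] := in_s k.
have [y yP] : exists y, forall k, (s k).2 <= y <= (s k).2 + h * q k.
  apply: nested_segments => k; first by rewrite ltW// mulr_gt0.
    by have [_ []] := in_s k.
  by have [_ []] := in_s k.
have wh0 : 0 < (w + h) ^+ 2 by rewrite exprn_gt0// addr_gt0.
have [d d0 dP] := Wloc x y _ (divr_gt0 e0_gt0 wh0).
have [k kd] : exists k, (w + h) * q k < d.
  have : (fun k => (w + h) * q k) @ \oo --> (0 : R).
    rewrite -[X in _ --> X](mulr0 (w + h)); apply: cvgMr.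
    by apply: cvg_expr; rewrite ger0_norm ?invr_ge0// invf_lt1// ltr1n.
  move=> /cvgrPdist_lt/(_ d d0)[k _ /(_ k (leqnn k))] /=.
  by rewrite sub0r normrN ger0_norm ?mulr_ge0// ?addr_ge0 ?ltW//; exists k.
have wk : 0 < w * q k by rewrite mulr_gt0.
have hk : 0 < h * q k by rewrite mulr_gt0.
have := dP (s k).1 (s k).2 (w * q k) (h * q k).
move: kd; rewrite mulrDl => kd.
move=> /(_ ltac:(lra) ltac:(lra) (xP k) (yP k)); apply/negP; rewrite -ltNge.
apply: le_lt_trans (bad_s k); rewrite -mulrDl exprMn mulrA divfK//.
by rewrite gt_eqF.
Qed.

End Bisection.

(** * Complex differentiability *)

(** The quotient of the definition has a punctured neighbourhood and a division
    in it; the linear approximation has neither, and it can be transported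
    along norm-preserving changes of variable. *)
Lemma derive_approxP (K : numFieldType) (f : K^o -> K^o) (x d : K^o) :
  is_derive x 1 f d <-> forall e : K, 0 < e ->
    \forall w \near x, `|f w - f x - d * (w - x)| <= e * `|w - x|.
Proof.
have quotE (h : K) : h != 0 ->
    `|f (x + h) - f x - d * (x + h - x)| =
    `|d - h^-1 *: (f (h *: 1 + x) - f x)| * `|h|.
  move=> h0; rewrite -normrM; rewrite -normrN; congr `| _ |.
  rewrite /GRing.scale/= mulr1 (addrC h x); field.
  exact: h0.
split=> [fd e e0|H].
  have /cvgrPdist_le : h^-1 *: (f (h *: 1 + x) - f x) @[h --> 0^'] --> d.
    by have := @ex_derive _ _ _ _ _ _ _ fd; rewrite -[d in _ --> d]derive_val.
  move=> /(_ e e0); rewrite near_withinE => hd.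
  apply/nbhs0P; apply: filterS hd => h /= hd.
  have [->|h0] := eqVneq h 0; first by rewrite addr0 !subrr mulr0 subrr !normr0 mulr0.
  by rewrite quotE// [x + h]addrC addrK ler_wpM2r// hd.
suff cvd : h^-1 *: (f (h *: 1 + x) - f x) @[h --> 0^'] --> d.
  apply: DeriveDef; first by apply/cvg_ex; exists d.
  exact/cvg_lim.
apply/cvgrPdist_le => e e0; rewrite near_withinE; have /nbhs0P := H e e0.
apply: filterS => h /= + h0.
by rewrite quotE// [x + h]addrC addrK ler_pM2r// normr_gt0.
Qed.

Section Complex.
Local Open Scope complex_scope.
Local Notation Re := complex.Re.
Local Notation Im := complex.Im.
Variable R : realType.
Implicit Types (z w : R[i]).

Lemma normc_ge_Im z : `|Im z|%:C <= `|z|.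
Proof.
by rewrite normc_def lecR -sqrtr_sqr ler_wsqrtr// lerDr sqr_ge0.
Qed.

Lemma normc_le_ReIm z : `|z| <= (`|Re z| + `|Im z|)%:C.
Proof.
rewrite normc_def lecR.
rewrite -[leRHS]ger0_norm ?addr_ge0// -sqrtr_sqr ler_wsqrtr//.
rewrite sqrrD !real_normK ?num_real// [leRHS]addrAC lerDl.
by rewrite mulrn_wge0// mulr_ge0.
Qed.

(** A positive element of R[i] is real, so the radii can be taken in R. *)
Lemma near_complexP z (P : R[i] -> Prop) :
  (\forall w \near (z : R[i]^o), P w) <->
  exists2 r : R, 0 < r & forall w, `|w - z| < r%:C -> P w.
Proof.
split=> [/nbhs_ballP[e /= e0 eP]|[r r0 rP]].
  exists (Re e); first by move: e0; rewrite ltcE => /andP[].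
  move=> w wz; apply: eP; rewrite /ball/= distrC.
  by move: e0 wz; rewrite !ltcE/= => /andP[/eqP -> _].
have r0' : 0 < r%:C by rewrite ltcR.
apply: filterS (nbhsx_ballx (z : R[i]^o) _ r0') => w.
by rewrite /ball/= distrC; exact: rP.
Qed.

Lemma continuous_Re : continuous (@Re R : R[i]^o -> R).
Proof.
move=> z; apply/(@cvgrPdist_lt _ _ _ _ (nbhs_filter (z : R[i]^o))) => e e0.
apply/near_complexP; exists e => // w wz.
rewrite -ltcR; apply: le_lt_trans wz; rewrite distrC.
by apply: le_trans (normc_ge_Re _); rewrite raddfB.
Qed.

Lemma continuous_Im : continuous (@Im R : R[i]^o -> R).
Proof.
move=> z; apply/(@cvgrPdist_lt _ _ _ _ (nbhs_filter (z : R[i]^o))) => e e0.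
apply/near_complexP; exists e => // w wz.
rewrite -ltcR; apply: le_lt_trans wz; rewrite distrC.
by apply: le_trans (normc_ge_Im _); rewrite raddfB.
Qed.

Lemma continuous_horizontal (y : R) : continuous (fun x => x +i* y : R[i]^o).
Proof.
move=> x; apply/cvgrPdist_lt => e; rewrite ltcE/= => /andP[/eqP e1 e0].
near=> t; apply: (le_lt_trans (normc_le_ReIm _)) => /=.
rewrite subrr normr0 addr0 ltcE/= e1 eqxx/=.
by near: t; apply: cvgr_dist_lt.
Unshelve. all: by end_near. Qed.

Lemma continuous_vertical (x : R) : continuous (fun y => x +i* y : R[i]^o).
Proof.
move=> y; apply/cvgrPdist_lt => e; rewrite ltcE/= => /andP[/eqP e1 e0].
near=> t; apply: (le_lt_trans (normc_le_ReIm _)) => /=.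
rewrite subrr normr0 add0r ltcE/= e1 eqxx/=.
by near: t; apply: cvgr_dist_lt.
Unshelve. all: by end_near. Qed.

Lemma complex_derive_approxP (E : R[i]^o -> R[i]^o) (p d : R[i]^o) :
  is_derive p 1 E d <-> forall e : R, 0 < e -> exists2 r : R, 0 < r &
    forall w : R[i],
    `|w - p| < r%:C -> `|E w - E p - d * (w - p)| <= e%:C * `|w - p|.
Proof.
split=> [/derive_approxP Ed e e0|H].
  by apply/near_complexP; apply: Ed; rewrite ltcR.
apply/derive_approxP => -[e e'] e0; apply/near_complexP.
move: e0; rewrite ltcE/= => /andP[/eqP -> e0]; exact: H.
Qed.

Definition entire (E : R[i]^o -> R[i]^o) := forall z : R[i]^o, derivable E z 1.

Lemma entire_comp (E G : R[i]^o -> R[i]^o) :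
  entire E -> entire G -> entire (fun z => E (G z)).
Proof.
move=> dE dG z; apply/derivable1_diffP.
by apply: (@differentiable_comp _ _ _ _ G E); apply/derivable1_diffP.
Qed.

Lemma entireM (E G : R[i]^o -> R[i]^o) :
  entire E -> entire G -> entire (fun z => E z * G z).
Proof. by move=> dE dG z; exact: derivableM (dE z) (dG z). Qed.

Lemma entireB (E G : R[i]^o -> R[i]^o) :
  entire E -> entire G -> entire (fun z => E z - G z).
Proof. by move=> dE dG z; exact: derivableB (dE z) (dG z). Qed.

Lemma entireD (E G : R[i]^o -> R[i]^o) :
  entire E -> entire G -> entire (fun z => E z + G z).
Proof. by move=> dE dG z; exact: derivableD (dE z) (dG z). Qed.

Lemma entire_cst (c : R[i]^o) : entire (fun=> c).
Proof. by move=> z; exact: derivable_cst. Qed.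

Lemma entire_id : entire id.
Proof. by move=> z; exact: derivable_id. Qed.

Lemma entire_affine (a b z0 : R[i]^o) :
  entire (fun z => a + b * (z - z0)).
Proof.
have dB := entireB entire_id (@entire_cst z0).
have dM := entireM (@entire_cst b) dB.
exact: entireD (@entire_cst a) dM.
Qed.

Lemma entire_continuous (E : R[i]^o -> R[i]^o) : entire E -> continuous E.
Proof.
by move=> dE z; apply/differentiable_continuous/derivable1_diffP/dE.
Qed.

End Complex.

(** * The Cauchy-Goursat theorem for rectangles *)
Section Goursat.
Local Open Scope complex_scope.
Local Notation Re := complex.Re.
Local Notation Im := complex.Im.
Variable R : realType.
Variable E : R[i]^o -> R[i]^o.
Hypothesis dE : entire E.

(** Real part of the integral of E over the boundary of the rectangle with
    lower left corner a + i c, width w and height h.  Opposite sides share one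
    integral, because the difference of an affine function on two opposite
    sides is constant. *)
Definition rectangle_int (a c w h : R) : R :=
  segment_int (fun x => Re (E (x +i* c)) - Re (E (x +i* (c + h)))) a (a + w) +
  segment_int (fun y => Im (E (a +i* y)) - Im (E ((a + w) +i* y))) c (c + h).

Lemma continuous_Re_horizontal c : continuous (fun x : R => Re (E (x +i* c))).
Proof.
move=> x; apply: (@continuous_comp _ _ _ (fun x => x +i* c : R[i]^o)
  (fun z : R[i]^o => Re (E z))); first exact: continuous_horizontal.
apply: (@continuous_comp _ _ _ E (@Re R)); last exact: continuous_Re.
exact: entire_continuous.
Qed.

Lemma continuous_Im_vertical a : continuous (fun y : R => Im (E (a +i* y))).
Proof.
move=> y; apply: (@continuous_comp _ _ _ (fun y => a +i* y : R[i]^o)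
  (fun z : R[i]^o => Im (E z))); first exact: continuous_vertical.
apply: (@continuous_comp _ _ _ E (@Im R)); last exact: continuous_Im.
exact: entire_continuous.
Qed.

Lemma rectangle_intDx a c w1 w2 h : 0 <= w1 -> 0 <= w2 ->
  rectangle_int a c (w1 + w2) h =
  rectangle_int a c w1 h + rectangle_int (a + w1) c w2 h.
Proof.
move=> w10 w20; rewrite /rectangle_int.
have cRe := continuous_Re_horizontal; have cIm := continuous_Im_vertical.
rewrite (@segment_int_split _ _ a (a + w1)) ?lerDl// ?lerD2l ?lerDl//; last first.
  by move=> x; exact: cvgB (cRe _ x) (cRe _ x).
rewrite !segment_intB// [a + (w1 + w2)]addrA; ring.
Qed.

Lemma rectangle_intDy a c w h1 h2 : 0 <= h1 -> 0 <= h2 ->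
  rectangle_int a c w (h1 + h2) =
  rectangle_int a c w h1 + rectangle_int a (c + h1) w h2.
Proof.
move=> h10 h20; rewrite /rectangle_int.
have cRe := continuous_Re_horizontal; have cIm := continuous_Im_vertical.
rewrite (@segment_int_split _ _ c (c + h1)) ?lerDl// ?lerD2l ?lerDl//; last first.
  by move=> y; exact: cvgB (cIm _ y) (cIm _ y).
rewrite !segment_intB// [c + (h1 + h2)]addrA; ring.
Qed.

(** Near a point p, E differs by a small multiple of the size of the rectangle
    from the affine function L z = E p + d (z - p), for which the horizontal and
    the vertical sides contribute Im d w h and - Im d w h. *)
Lemma rectangle_int_small x y e : 0 < e ->
  exists2 d, 0 < d & forall a c w h,
    0 < w < d -> 0 < h < d -> a <= x <= a + w -> c <= y <= c + h ->
    `|rectangle_int a c w h| <= e * (w + h) ^+ 2.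
Proof.
move=> e0; have e20 : 0 < e / 2 by rewrite divr_gt0.
have [d [r r0 rP]] : exists (d : R[i]), exists2 r : R, 0 < r &
    forall w : R[i], `|w - (x +i* y)| < r%:C ->
    `|E w - E (x +i* y) - d * (w - (x +i* y))| <=
      (e / 2)%:C * `|w - (x +i* y)|.
  exists ('D_1 E (x +i* y)); exact: (complex_derive_approxP _ _ _).1.
exists (r / 2); first by rewrite divr_gt0.
move=> a c w h wr hr ax cy.
pose L z := E (x +i* y) + d * (z - (x +i* y)).
have EL x' y' : a <= x' <= a + w -> c <= y' <= c + h ->
    `|E (x' +i* y') - L (x' +i* y')| <= (e / 2 * (w + h))%:C.
  move=> ax' cy'.
  have wh : `|(x' +i* y') - (x +i* y)| <= (w + h)%:C.
    rewrite (le_trans (normc_le_ReIm _))// lecR/= lerD// ler_norml; lra.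
  rewrite /L opprD addrA (le_trans (rP _ _))//.
    by apply: (le_lt_trans wh); rewrite ltcR; lra.
  have -> : (e / 2 * (w + h))%:C = (e / 2)%:C * (w + h)%:C by exact: rmorphM.
  by rewrite ler_wpM2l// lecR ltW.
have ReEL x' y' : a <= x' <= a + w -> c <= y' <= c + h ->
    `|Re (E (x' +i* y')) - Re (L (x' +i* y'))| <= e / 2 * (w + h).
  move=> /EL/[apply] h1; rewrite -lecR; apply: le_trans h1.
  by rewrite -raddfB; exact: normc_ge_Re.
have ImEL x' y' : a <= x' <= a + w -> c <= y' <= c + h ->
    `|Im (E (x' +i* y')) - Im (L (x' +i* y'))| <= e / 2 * (w + h).
  move=> /EL/[apply] h1; rewrite -lecR; apply: le_trans h1.
  by rewrite -raddfB; exact: normc_ge_Im.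
have cRe := continuous_Re_horizontal; have cIm := continuous_Im_vertical.
pose d2 := Im d.
have ReL x' : Re (L (x' +i* c)) - Re (L (x' +i* (c + h))) = d2 * h.
  by rewrite /L /d2; case: (d) (E _) => d1 d2' [e1 e2'] /=; ring.
have ImL y' : Im (L (a +i* y')) - Im (L ((a + w) +i* y')) = - d2 * w.
  by rewrite /L /d2; case: (d) (E _) => d1 d2' [e1 e2'] /=; ring.
have H1 : `|segment_int (fun x => Re (E (x +i* c)) - Re (E (x +i* (c + h)))) a (a + w)
    - d2 * h * (a + w - a)| <= e * (w + h) * (a + w - a).
  apply: segment_int_near_cst => [x'||x' ax'].
  - exact: cvgB (cRe _ x') (cRe _ x').
  - lra.
  - have := ReEL x' c ax' ltac:(lra); have := ReEL x' (c + h) ax' ltac:(lra).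
    by rewrite -(ReL x') !ler_norml; lra.
have H2 : `|segment_int (fun y => Im (E (a +i* y)) - Im (E ((a + w) +i* y))) c (c + h)
    - - d2 * w * (c + h - c)| <= e * (w + h) * (c + h - c).
  apply: segment_int_near_cst => [y'||y' cy'].
  - exact: cvgB (cIm _ y') (cIm _ y').
  - lra.
  - have := ImEL a y' ltac:(lra) cy'; have := ImEL (a + w) y' ltac:(lra) cy'.
    by rewrite -(ImL y') !ler_norml; lra.
move: H1 H2; rewrite /rectangle_int; set A := segment_int _ _ _; set B := segment_int _ _ _.
rewrite !(addrAC _ _ (- _)) !subrr !add0r expr2 => H1 H2.
have -> : A + B = A - d2 * h * w + (B - - d2 * w * h) by ring.
apply: (le_trans (ler_normD _ _)); apply: (le_trans (lerD H1 H2)).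
by rewrite -mulrDr mulrA.
Qed.

Theorem goursat a c w h : 0 < w -> 0 < h -> rectangle_int a c w h = 0.
Proof.
apply: rectangle_bisection => {a c w h} [a c w h w0 h0|a c w h w0 h0|].
- by rewrite -rectangle_intDx -?splitr// divr_ge0// ltW.
- by rewrite -rectangle_intDy -?splitr// divr_ge0// ltW.
- exact: rectangle_int_small.
Qed.

End Goursat.

(** * The complex exponential *)
Section ComplexExponential.
Local Open Scope complex_scope.
Local Notation Re := complex.Re.
Local Notation Im := complex.Im.
Variable R : realType.
Implicit Types (z w : R[i]).

Definition cexp z : R[i] :=
  (expR (Re z) * cos (Im z)) +i* (expR (Re z) * sin (Im z)).

Lemma cexpD z w : cexp (z + w) = cexp z * cexp w.
Proof.
case: z w => [a b] [c d]; rewrite /cexp /= expRD cosD sinD.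
by simpc; congr (_ +i* _); ring.
Qed.

Lemma cexp_periodic z : cexp (z + 0 +i* (pi *+ 2)) = cexp z.
Proof. by case: z => a b; rewrite /cexp /= addr0 cosD2pi sinD2pi. Qed.

Lemma norm_cexp z : `|cexp z| = (expR (Re z))%:C.
Proof.
rewrite normc_def /= !exprMn -mulrDr cos2Dsin2 mulr1 sqrtr_sqr ger0_norm//.
Qed.

(** The real and imaginary parts of cexp (s + i t) - 1 - (s + i t) are
    (e^s - 1 - s) cos t + (1 + s) (cos t - 1) and
    e^s (sin t - t) + (e^s - 1) t,
    where every summand is small by the derivatives at 0 of the three real
    functions. *)
Lemma cexp_approx0 (e : R) : 0 < e -> exists2 r : R, 0 < r & forall w,
  `|w| < r%:C -> `|cexp w - 1 - w| <= e%:C * `|w|.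
Proof.
move=> e0.
(* for |s|, |t| <= q the four summands are at most e1 q, 2 e1 q, 3 e1 q and
   2 e1 q *)
pose e1 := Num.min e 1 / 8.
have m0 : 0 < Num.min e 1 by rewrite lt_min e0 ltr01.
have [e1e e11] : 8 * e1 <= e /\ 8 * e1 <= 1.
  have -> : 8 * e1 = Num.min e 1 by rewrite /e1; field.
  by rewrite !ge_min !lexx orbT.
have e10 : 0 < e1 by rewrite divr_gt0.
have near0 (f : R -> R) (d : R) : is_derive (0 : R) 1 f d ->
    exists2 r : R, 0 < r & forall t, `|t| < r -> `|f t - f 0 - d * t| <= e1 * `|t|.
  move=> /derive_approxP/(_ e1 e10)/nbhs_ballP[r /= r0 rP]; exists r => // t tr.
  have := rP t; rewrite /ball/= sub0r normrN subr0; exact.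
have [r1 r10 exp0] := near0 _ _ (is_derive_expR 0).
have [r2 r20 sin0'] := near0 _ _ (is_derive_sin 0).
have [r3 r30 cos0'] := near0 _ _ (is_derive_cos 0).
move: exp0 sin0' cos0'; rewrite expR0 cos0 sin0 => exp0 sin0' cos0'.
exists (Num.min (Num.min (Num.min r1 r2) (Num.min r3 1)) e1).
  by rewrite !lt_min r10 r20 r30 e10 ltr01.
move=> [s t] wr.
move: (wr); rewrite [`|_|]normc_def ltcR; set q := Num.sqrt _ => qr.
have wq : `|s +i* t| = q%:C by rewrite normc_def.
have sq : `|s| <= q by have := normc_ge_Re (s +i* t); rewrite wq lecR.
have tq : `|t| <= q by have := normc_ge_Im (s +i* t); rewrite wq lecR.
move: qr; rewrite !lt_min -!andbA => /and5P[qr1 qr2 qr3 q1 qe].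
have {}exp0 := exp0 s (le_lt_trans sq qr1).
have {}sin0' := sin0' t (le_lt_trans tq qr2).
have {}cos0' := cos0' t (le_lt_trans tq qr3).
rewrite mul1r in exp0; rewrite subr0 mul1r in sin0'.
rewrite oppr0 mul0r subr0 in cos0'.
have q0 : 0 <= q by exact: sqrtr_ge0.
have e1q : e1 * `|s| <= e1 * q by rewrite ler_wpM2l// ltW.
have e1q' : e1 * `|t| <= e1 * q by rewrite ler_wpM2l// ltW.
have eq0 : 0 <= e1 * q by rewrite mulr_ge0// ltW.
have eqq : e1 * q <= q by rewrite ler_piMl//; lra.
have X1 : `|expR s - 1| <= 2 * q.
  by move: sq exp0; rewrite !ler_norml; lra.
apply: (le_trans (normc_le_ReIm _)); rewrite -rmorphM lecR /=.
have -> : expR s * cos t - 1 - s = (expR s - 1 - s) * cos t + (1 + s) * (cos t - 1).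
  ring.
have -> : expR s * sin t - 0 - t = expR s * (sin t - t) + (expR s - 1) * t.
  ring.
have B1 : `|(expR s - 1 - s) * cos t| <= e1 * q.
  rewrite normrM -[leRHS]mulr1 ler_pM// ?cos_max//; exact: le_trans exp0 _.
have B2 : `|(1 + s) * (cos t - 1)| <= 2 * (e1 * q).
  rewrite normrM ler_pM//; last exact: le_trans cos0' _.
  by move: sq; rewrite !ler_norml; lra.
have B3 : `|expR s * (sin t - t)| <= 3 * (e1 * q).
  rewrite normrM ler_pM//; last exact: le_trans sin0' _.
  by move: sq exp0; rewrite !ler_norml; lra.
have B4 : `|(expR s - 1) * t| <= 2 * (e1 * q).
  rewrite normrM mulrA; apply: ler_pM => //.
  apply: (le_trans X1); rewrite ler_pM2l//; exact: ltW.
apply: (@le_trans _ _ (8 * e1 * q)); last by rewrite ler_wpM2r.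
apply: (le_trans (lerD (ler_normD _ _) (ler_normD _ _))).
rewrite -mulrA; lra.
Qed.

Lemma cexp_is_derive (z : R[i]^o) : is_derive z 1 (cexp : R[i]^o -> R[i]^o) (cexp z).
Proof.
apply/complex_derive_approxP => e e0.
have cz0 : 0 < expR (Re z) := expR_gt0 _.
have [r r0 rP] := cexp_approx0 (divr_gt0 e0 cz0).
exists r => // w /rP wr.
have -> : cexp w - cexp z - cexp z * (w - z) =
    cexp z * (cexp (w - z) - 1 - (w - z)).
  by rewrite -{1}(subrK z w) (cexpD (w - z) z); ring.
rewrite normrM norm_cexp.
have -> : e%:C = (expR (Re z))%:C * (e / expR (Re z))%:C.
  by rewrite -rmorphM /= mulrC divfK// gt_eqF.
by rewrite -mulrA ler_wpM2l// lecR ltW.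
Qed.

End ComplexExponential.

(** * Vertical integrals of periodic entire functions *)
Section MeanValue.
Local Open Scope complex_scope.
Local Notation Re := complex.Re.
Local Notation Im := complex.Im.
Variable R : realType.
Implicit Types (z w : R[i]).

Lemma entire_cexp : entire (@cexp R).
Proof. by move=> z; exact: (@ex_derive _ _ _ _ _ _ _ (cexp_is_derive z)). Qed.

Let tau : R := pi *+ 2.

Let tau_gt0 : 0 < tau.
Proof. by rewrite /tau mulrn_wgt0// pi_gt0. Qed.

(** By periodicity the two horizontal sides of the rectangle cancel, and the
    vanishing of its boundary integral compares the two vertical sides. *)
Lemma periodic_vertical_int (E : R[i]^o -> R[i]^o) (s s' : R) : entire E ->
  (forall x : R, E (x +i* tau) = E (x +i* 0)) -> s < s' ->
  segment_int (fun y => Im (E (s +i* y))) 0 tau =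
  segment_int (fun y => Im (E (s' +i* y))) 0 tau.
Proof.
move=> dE perE ss'; apply/eqP; rewrite -subr_eq0 -segment_intB; last 2 first.
- exact: continuous_Im_vertical.
- exact: continuous_Im_vertical.
have ss0 : 0 < s' - s by rewrite subr_gt0.
have := goursat dE s 0 ss0 tau_gt0; rewrite /rectangle_int add0r subrKC.
rewrite (_ : (fun x => _ - Re (E (x +i* tau))) = (fun=> 0)); last first.
  by apply/funext => x; rewrite perE subrr.
by rewrite segment_int_cst ?ltW// mul0r add0r => ->.
Qed.

Lemma periodic_vertical_int0 (E : R[i]^o -> R[i]^o) (s : R) : entire E ->
  (forall x : R, E (x +i* tau) = E (x +i* 0)) ->
  (forall e, 0 < e -> exists s0, forall x y, x <= s0 -> `|Im (E (x +i* y))| <= e) ->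
  segment_int (fun y => Im (E (s +i* y))) 0 tau = 0.
Proof.
move=> dE perE limE; apply/eqP; rewrite -normr_le0; apply/ler_addgt0Pr => e e0.
have [s0 s0P] := limE _ (divr_gt0 e0 tau_gt0).
pose t := Num.min s0 (s - 1).
have ts : t < s by rewrite gt_min; apply/orP; right; rewrite ltrBlDr ltrDl.
rewrite -(periodic_vertical_int dE perE ts) add0r.
apply: (@le_trans _ _ (e / tau * (tau - 0))).
  apply: segment_int_bound => [||y _]; last 1 first.
  - by apply: s0P; rewrite ge_min lexx.
  - exact: continuous_Im_vertical.
  - exact: ltW.
by rewrite subr0 divfK// gt_eqF.
Qed.

(** The first Fourier coefficient of Im H on the circle of radius e^s around z0
    vanishes when H z = o(z - z0).  Both H (z0 + exp w) exp (- w) and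
    H (z0 + exp w) exp w tend to 0 as Re w -> -oo, so their vertical integrals
    vanish; the combination below of their imaginary parts eliminates Re H. *)
Lemma int_Im_remainder_cos (H : R[i]^o -> R[i]^o) (z0 : R[i]) (s : R) :
  entire H ->
  (forall e : R, 0 < e -> exists2 r : R, 0 < r & forall z,
     `|z - z0| < r%:C -> `|H z| <= e%:C * `|z - z0|) ->
  segment_int (fun y => Im (H (z0 + cexp (s +i* y))) * cos y) 0 tau = 0.
Proof.
move=> dH Ho.
have cexp_tau x : cexp (x +i* tau) = cexp (x +i* 0).
  have := cexp_periodic (x +i* 0); rewrite -/tau => <-; congr cexp.
  by simpc.
have cexpN_tau x : cexp (- (x +i* tau)) = cexp (- (x +i* 0)).
  have := cexp_periodic (- (x +i* tau)); rewrite -/tau => <-; congr cexp.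
  by apply/eqP; rewrite eq_complex /= addr0 addNr oppr0 !eqxx.
have dHe : entire (fun w => H (z0 + cexp w)).
  have dc := entireD (@entire_cst R z0) entire_cexp.
  exact: entire_comp dH dc.
have dNe : entire (fun w : R[i]^o => cexp (- w)).
  apply: (entire_comp entire_cexp) => w.
  exact: derivableN (@derivable_id _ _ _ _).
have small e : 0 < e -> exists s0, forall x y, x <= s0 ->
    `|H (z0 + cexp (x +i* y))| <= (e * expR x)%:C /\ expR x <= 1.
  move=> e0; have [r r0 rP] := Ho e e0.
  exists (Num.min (ln (r / 2)) 0) => x y; rewrite le_min => /andP[xr x0].
  split; last by rewrite -expR0 ler_expR.
  have := rP (z0 + cexp (x +i* y)); rewrite addrC addKr norm_cexp /= -rmorphM/=.
  rewrite addrC; apply; rewrite ltcR.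
  have r20 : 0 < r / 2 by rewrite divr_gt0.
  apply: (@le_lt_trans _ _ (r / 2)); last by lra.
  by rewrite -[r / 2]lnK ?posrE// ler_expR.
pose K1 : R[i]^o -> R[i]^o := fun w => H (z0 + cexp w) * cexp (- w).
pose K2 : R[i]^o -> R[i]^o := fun w => H (z0 + cexp w) * cexp w.
have dK1 : entire K1 by exact: entireM.
have dK2 : entire K2 by exact: entireM dHe entire_cexp.
have I1 : segment_int (fun y => Im (K1 (s +i* y))) 0 tau = 0.
  apply: periodic_vertical_int0 => // [x|e e0].
    by rewrite /K1 cexp_tau cexpN_tau.
  have [s0 s0P] := small e e0; exists s0 => x y /(s0P x y)[hx _].
  rewrite -lecR; apply: (le_trans (normc_ge_Im _)).
  rewrite /K1 normrM norm_cexp /=.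
  apply: (le_trans (ler_wpM2r _ hx)); first by rewrite ler0c expR_ge0.
  by rewrite -rmorphM /= -mulrA -expRD subrr expR0 mulr1.
have I2 : segment_int (fun y => Im (K2 (s +i* y))) 0 tau = 0.
  apply: periodic_vertical_int0 => // [x|e e0].
    by rewrite /K2 cexp_tau.
  have [s0 s0P] := small e e0; exists s0 => x y /(s0P x y)[hx x1].
  rewrite -lecR; apply: (le_trans (normc_ge_Im _)).
  rewrite /K2 normrM norm_cexp /=.
  apply: (le_trans (ler_wpM2r _ hx)); first by rewrite ler0c expR_ge0.
  rewrite -rmorphM /= lecR -mulrA ler_piMr//; first exact: ltW.
  by rewrite mulr_ile1// expR_ge0.
have cK1 : continuous (fun y => Im (K1 (s +i* y)))
  := @continuous_Im_vertical _ _ dK1 s.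
have cK2 : continuous (fun y => Im (K2 (s +i* y)))
  := @continuous_Im_vertical _ _ dK2 s.
rewrite (_ : (fun y => _) = (fun y => expR s / 2 * Im (K1 (s +i* y)) +
    expR (- s) / 2 * Im (K2 (s +i* y)))).
  rewrite segment_intD ?segment_intZ ?I1 ?I2 ?mulr0 ?addr0//.
  - by move=> y; apply: cvgMr; exact: cK1.
  - by move=> y; apply: cvgMr; exact: cK2.
apply/funext => y; rewrite /K1 /K2; case: (H _) => U V.
rewrite /cexp /= cosN sinN expRN; field.
by rewrite gt_eqF// expR_gt0.
Qed.

End MeanValue.

(** * Growth of the imaginary part of an entire function *)
Section Growth.
Local Open Scope complex_scope.
Local Notation Re := complex.Re.
Local Notation Im := complex.Im.
Variable R : realType.
Implicit Types (z w : R[i]).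

Let tau : R := pi *+ 2.

Let tau_gt0 : 0 < tau.
Proof. by rewrite /tau mulrn_wgt0// pi_gt0. Qed.

Lemma continuous_trig_cos (v0 r d1 d2 : R) :
  continuous (fun y => (v0 + r * (d1 * sin y + d2 * cos y)) * cos y).
Proof.
move=> y; apply/differentiable_continuous/derivable1_diffP.
exact: ex_derive.
Qed.

Lemma int_trig_cos (v0 r d1 d2 : R) :
  segment_int (fun y => (v0 + r * (d1 * sin y + d2 * cos y)) * cos y) 0 tau =
  r * d2 * pi.
Proof.
pose P y : R := v0 * sin y +
  r * (d1 / 2 * (sin y * sin y) + d2 / 2 * (y + sin y * cos y)).
pose f y : R := (v0 + r * (d1 * sin y + d2 * cos y)) * cos y.
have cf : continuous f by exact: continuous_trig_cos.
have dP (y : R) : is_derive y 1 P (f y).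
  have ds := is_derive_sin y; have dc := is_derive_cos y.
  have dQ := is_deriveD (is_deriveZ v0 ds) (is_deriveZ r
    (is_deriveD (is_deriveZ (d1 / 2) (is_deriveM ds ds))
      (is_deriveZ (d2 / 2) (is_deriveD (is_derive_id y 1) (is_deriveM ds dc))))).
  apply: (@is_derive_eq _ _ _ _ _ _ _ _ dQ); rewrite /GRing.scale/= /f.
  have -> : 1 + (sin y * - sin y + cos y * cos y) = 2 * (cos y * cos y).
    by have := cos2Dsin2 y; rewrite !expr2; lra.
  by field.
rewrite (segment_int_FTC tau_gt0 cf dP) /P /tau sin2pi sin0; by field.
Qed.

(** Subtracting the first order expansion of F at z0 leaves a remainder to which
    int_Im_remainder_cos applies.  Hence the cosine coefficient of Im F on the
    circle is the one of the expansion, pi r Im d, while it is at most 2 pi M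
    by the bound on Im F. *)
Lemma Im_derive_bound (F : R[i]^o -> R[i]^o) (z0 d : R[i]^o) (r M : R) :
  entire F -> is_derive z0 1 F d -> 0 < r ->
  (forall z, `|z - z0| = r%:C -> `|Im (F z)| <= M) -> `|Im d| <= 2 * M / r.
Proof.
move=> dF Fd r0 FM.
pose H : R[i]^o -> R[i]^o := fun z => F z - (F z0 + d * (z - z0)).
have dH : entire H := entireB dF (@entire_affine _ (F z0) d z0).
have Ho (e : R) : 0 < e -> exists2 r : R, 0 < r & forall z,
     `|z - z0| < r%:C -> `|H z| <= e%:C * `|z - z0|.
  move=> e0; have /complex_derive_approxP/(_ e e0)[r' r'0 rP] := Fd.
  by exists r' => // z /rP; rewrite /H opprD addrA.
pose s := ln r.
have sr : expR s = r by rewrite lnK.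
have := int_Im_remainder_cos s dH Ho.
pose v y := Im (F (z0 + cexp (s +i* y))).
pose B y := (Im (F z0) + r * (Re d * sin y + Im d * cos y)) * cos y.
rewrite (_ : (fun y => _) = (fun y => v y * cos y - B y)); last first.
  apply/funext => y; rewrite /H /v /B; case: (F _) => a b.
  case: (F _) => a' b'; case: (d) => d1 d2; case: (z0) => x0 y0.
  by rewrite /cexp /= sr; ring.
have cv : continuous (fun y => v y * cos y).
  move=> y; apply: cvgM; last exact: continuous_cos.
  have dG : entire (fun w => F (z0 + cexp w)).
    have dc := entireD (@entire_cst _ z0) (@entire_cexp R).
    exact: entire_comp dF dc.
  exact: (@continuous_Im_vertical _ _ dG s).
have cB : continuous B by exact: continuous_trig_cos.
rewrite segment_intB// int_trig_cos => /eqP; rewrite subr_eq0 => /eqP vd.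
have pi0 : 0 < pi :> R := pi_gt0 R.
have : `|segment_int (fun y => v y * cos y) 0 tau| <= M * (tau - 0).
  apply: segment_int_bound => // [|y _]; first exact: ltW.
  rewrite normrM -[leRHS]mulr1 ler_pM// ?cos_max// FM// addrC addKr norm_cexp/=.
  by rewrite sr.
rewrite vd !normrM (ger0_norm (ltW r0)) (ger0_norm (ltW pi0)) subr0 /tau.
rewrite -mulr_natr => h; rewrite ler_pdivlMr// -(ler_pM2r pi0); lra.
Qed.

(** The map z |-> F (z0 + i (z - z0)) takes the same values on the circle and
    has derivative i d at z0, whose imaginary part is Re d. *)
Lemma Re_derive_bound (F : R[i]^o -> R[i]^o) (z0 d : R[i]^o) (r M : R) :
  entire F -> is_derive z0 1 F d -> 0 < r ->
  (forall z, `|z - z0| = r%:C -> `|Im (F z)| <= M) -> `|Re d| <= 2 * M / r.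
Proof.
move=> dF Fd r0 FM; pose j : R[i] := 0 +i* 1.
have j1 : `|j| = 1 by rewrite normc_def /= expr0n expr1n add0r sqrtr1.
pose G : R[i]^o -> R[i]^o := fun z => F (z0 + j * (z - z0)).
have -> : Re d = Im (j * d) by case: (d) => a b /=; ring.
have dG : entire G by exact: entire_comp dF (@entire_affine _ z0 j z0).
apply: (@Im_derive_bound G z0 _ _ _ dG _ r0).
- apply/complex_derive_approxP => e e0.
  have /complex_derive_approxP/(_ e e0)[r' r'0 rP] := Fd.
  exists r' => // w wr; have := rP (z0 + j * (w - z0)).
  have -> : G z0 = F z0 by rewrite /G subrr mulr0 addr0.
  rewrite [_ - z0](_ : _ = j * (w - z0)); last by ring.
  by rewrite normrM j1 mul1r mulrA (mulrC d); exact.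
- by move=> z zr; apply: FM; rewrite addrC addKr normrM j1 mul1r.
Qed.

Lemma Im_is_derive_line (F D : R[i]^o -> R[i]^o) (z v : R[i]) (t : R) :
  (forall w : R[i]^o, is_derive w 1 F (D w)) ->
  is_derive t 1 (fun t : R => Im (F (z + t%:C * v))) (Im (D (z + t%:C * v) * v)).
Proof.
move=> dF; apply/derive_approxP => e e0.
(* an upper bound of |v| which is real and nonzero even for v = 0 *)
pose N := Re `|v| + 1.
have vN : `|v| <= N%:C.
  by rewrite /N normc_def /= lecR lerDl.
have N0 : 0 < N by rewrite /N normc_def/= ltr_wpDl// sqrtr_ge0.
have eN : 0 < e / N by rewrite divr_gt0.
have /complex_derive_approxP/(_ _ eN)[r r0 rP] := dF (z + t%:C * v).
apply/nbhs_ballP; exists (r / N) => /=; first by rewrite divr_gt0.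
move=> u; rewrite /ball/= distrC => utr.
have E1 : z + u%:C * v - (z + t%:C * v) = (u - t)%:C * v.
  by rewrite rmorphB /=; ring.
have nE1 : `|(u - t)%:C * v| <= (`|u - t| * N)%:C.
  rewrite normrM rmorphM/= ler_pM//.
  by apply: (le_trans (normc_le_ReIm _)); rewrite /= normr0 addr0.
have := rP (z + u%:C * v); rewrite E1 => H.
have {}H := H (le_lt_trans nE1 _).
have {}H : `|F (z + u%:C * v) - F (z + t%:C * v) - D (z + t%:C * v) * ((u - t)%:C * v)|
    <= (e * `|u - t|)%:C.
  apply: (le_trans (H _)); first by rewrite ltcR -ltr_pdivlMr.
  have -> : (e * `|u - t|)%:C = (e / N)%:C * (`|u - t| * N)%:C.
    by rewrite -rmorphM /=; congr (_ %:C); field; rewrite gt_eqF.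
  by rewrite ler_wpM2l// lecR ltW.
rewrite -lecR; apply: le_trans H; apply: le_trans (normc_ge_Im _).
rewrite lecR le_eqVlt; apply/orP; left; apply/eqP; congr `| _ |.
move: (F (z + u%:C * v)) (F (z + t%:C * v)) (D (z + t%:C * v)).
by case: (v) => v1 v2 [a b] [a' b'] [d1 d2] /=; ring.
Qed.

Lemma Im_mean_value (F D : R[i]^o -> R[i]^o) (z v : R[i]) :
  (forall w : R[i]^o, is_derive w 1 F (D w)) ->
  exists w, Im (F (z + v)) - Im (F z) = Im (D w * v).
Proof.
move=> dF; pose f (t : R) := Im (F (z + t%:C * v)).
have df (t : R) : is_derive t 1 f (Im (D (z + t%:C * v) * v)).
  exact: Im_is_derive_line.
have cf : {within `[0, 1], continuous f}.
  apply: continuous_subspaceT => x.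
  exact/differentiable_continuous/derivable1_diffP/ex_derive.
have [t _] := @MVT_segment R f _ 0 1 ler01 (fun x _ => df x) cf.
rewrite /f mul1r mul0r addr0 subr0 mulr1 => ->.
by exists (z + t%:C * v).
Qed.

Lemma le_of_le_div (a b K : R) : 0 <= K ->
  (forall r, 0 < r -> a <= b + K / r) -> a <= b.
Proof.
move=> K0 H; apply/ler_addgt0Pr => e e0.
have K1 : 0 < K + 1 by rewrite ltr_wpDl.
apply: (le_trans (H ((K + 1) / e) (divr_gt0 K1 e0))); rewrite lerD2l.
rewrite invf_div mulrCA ler_piMr//; first exact: ltW.
by rewrite ler_pdivrMr// mul1r lerDl.
Qed.

(** A Liouville theorem.  Circles of radius r -> +oo bound F' by the previous
    estimates; by the mean value theorem z |-> F (z + v) - F z then has a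
    bounded imaginary part, and the same estimates show that its derivative
    F' (z + v) - F' z is 0. *)
Theorem entire_Im_linear_growth (F : R[i]^o -> R[i]^o) (C : R) :
  entire F -> (forall z, `|Im (F z)| <= C * (1 + `|Im z|)) ->
  exists a b : R[i], forall z, F z = a + b * z.
Proof.
move=> dF FC; pose D z := 'D_1 F z.
have dD (z : R[i]^o) : is_derive z 1 F (D z) by exact/derivableP/dF.
have C0 : 0 <= C by have := FC 0; rewrite /= normr0 addr0 mulr1; exact: le_trans.
have bound (z : R[i]) (r : R) : 0 < r -> forall w, `|w - z| = r%:C ->
    `|Im (F w)| <= C * (1 + `|Im z| + r).
  move=> r0 w wz; apply: (le_trans (FC w)); rewrite ler_wpM2l// -addrA lerD2l.
  have -> : Im w = Im z + Im (w - z) by rewrite raddfB/=; ring.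
  apply: (le_trans (ler_normD _ _)); rewrite lerD2l.
  by rewrite -lecR -wz normc_ge_Im.
have Dbound x (z : R[i]) :
    (forall r, 0 < r -> x <= 2 * (C * (1 + `|Im z| + r)) / r) -> x <= 2 * C.
  move=> H; apply: (@le_of_le_div _ _ (2 * C * (1 + `|Im z|))) => [|r r0].
    by rewrite !mulr_ge0// addr_ge0.
  by apply: (le_trans (H r r0)); rewrite le_eqVlt; apply/orP; left; apply/eqP;
    field; rewrite gt_eqF.
have ImD z : `|Im (D z)| <= 2 * C.
  by apply: (Dbound _ z) => r r0; exact: (Im_derive_bound dF (dD z) r0 (bound z r r0)).
have ReD z : `|Re (D z)| <= 2 * C.
  by apply: (Dbound _ z) => r r0; exact: (Re_derive_bound dF (dD z) r0 (bound z r r0)).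
have Dcst z v : D (z + v) = D z.
  pose G : R[i]^o -> R[i]^o := fun z => F (z + v) - F z.
  have dG : entire G.
    have dv' := entireD (@entire_id R) (@entire_cst _ v).
    exact: entireB (entire_comp dF dv') dF.
  have dGD : is_derive (z : R[i]^o) 1 G (D (z + v) - D z).
    suff dv : is_derive (z : R[i]^o) 1 (fun w : R[i]^o => F (w + v)) (D (z + v)).
      exact: is_deriveB dv (dD z).
    apply/complex_derive_approxP => e e0.
    have /complex_derive_approxP/(_ e e0)[r r0 rP] := dD (z + v).
    exists r => // w wr; have := rP (w + v).
    by rewrite opprD addrACA subrr addr0; exact.
  pose M := 2 * C * (`|Re v| + `|Im v|).
  have GM w : `|Im (G w)| <= M.
    rewrite /G /M raddfB /=; have [w' ->] := Im_mean_value w v dD.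
    have := ImD w'; have := ReD w'; case: (D w') (v) => d1 d2 [v1 v2] /= h1 h2.
    apply: (le_trans (ler_normD _ _)); rewrite !normrM.
    have := ler_wpM2r (normr_ge0 v2) h1; have := ler_wpM2r (normr_ge0 v1) h2.
    lra.
  have M0 : 0 <= M by rewrite !mulr_ge0// addr_ge0.
  have zero (x : R) : (forall r, 0 < r -> `|x| <= 2 * M / r) -> x = 0.
    move=> H; apply/eqP; rewrite -normr_le0.
    by apply: (@le_of_le_div _ _ (2 * M)) => [|r /H]; rewrite ?mulr_ge0// add0r.
  have h1 : Re (D (z + v) - D z) = 0.
    by apply: zero => r r0; exact: (Re_derive_bound dG dGD r0 (fun w _ => GM w)).
  have h2 : Im (D (z + v) - D z) = 0.
    by apply: zero => r r0; exact: (Im_derive_bound dG dGD r0 (fun w _ => GM w)).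
  by apply/eqP; rewrite -subr_eq0 eq_complex h1 h2 !eqxx.
have {}Dcst z : D z = D 0 by rewrite -[z]add0r Dcst.
exists (F 0), (D 0) => z.
have h2 : Im (F z) - Im (F 0) = Im (D 0 * z).
  by have [w] := Im_mean_value 0 z dD; rewrite add0r Dcst.
have h1 : Re (F z) - Re (F 0) = Re (D 0 * z).
  pose j : R[i] := 0 +i* 1.
  have dj (w : R[i]^o) : is_derive w 1 (fun z => j * F z : R[i]^o) (j * D w).
    by have := @is_deriveZ _ _ _ F j w 1 _ (dD w).
  have := Im_mean_value 0 z dj; rewrite add0r => -[w].
  rewrite Dcst /j => h; move: (F z) (F 0) (D 0) h; case: (z) => z1 z2.
  by move=> [a b] [a' b'] [d1 d2] /=; lra.
apply/eqP; rewrite -subr_eq0 eq_complex; apply/andP; split; apply/eqP.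
- by rewrite raddfB raddfD /= -h1; ring.
- by rewrite raddfB raddfD /= -h2; ring.
Qed.

End Growth.

(** * Imaginary units and paravectors in the Clifford algebra *)
Section CliffordAlgebraFacts.
Variables (R : realType) (n : nat).
Implicit Types (x y J : clifford R n) (A B : {set 'I_n}).

Lemma symdiffK A B : symdiff A (symdiff A B) = B.
Proof. by apply/setP => i; rewrite !in_symdiff addbA addbb. Qed.

Lemma coef_bladeM A B x :
  coef (blade R A * x) B = blade_sign R A (symdiff A B) * coef x (symdiff A B).
Proof.
elim/clifford_blade_ind: x => [a x y IHx IHy|C].
  by rewrite mulrDr -scalerAr !Defs.coefD !Defs.coefZ IHx IHy mulrDr mulrCA.
rewrite blade_mul Defs.coefZ !coef_blade.
have -> : (B == symdiff A C) = (symdiff A B == C).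
  by apply/eqP/eqP => [->|<-]; rewrite symdiffK.
by case: eqVneq => [->|_]; rewrite ?mulr0.
Qed.

Lemma norm_blade_sign A B : `|blade_sign R A B| = 1.
Proof. by rewrite /blade_sign normrX normrN1 expr1n. Qed.

Lemma norm_coef x A : `|coef x A| <= `|x|.
Proof.
rewrite [leRHS]/Num.Def.normr/= mx_normrE.
have := le_bigmax (0 : R) (fun ij : 'I_1 * 'I_#|{set 'I_n}| => `|x ij.1 ij.2|)
  (ord0, enum_rank A).
exact.
Qed.

(** Multiplication by a blade permutes the coordinates up to sign. *)
Lemma norm_coef_bladeM A B x : `|coef x B| <= `|blade R A * x|.
Proof.
have := norm_coef (blade R A * x) (symdiff A B).
by rewrite coef_bladeM symdiffK normrM norm_blade_sign mul1r.
Qed.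

Lemma coef_sum I (r : seq I) (F : I -> clifford R n) A :
  coef (\sum_(i <- r) F i) A = \sum_(i <- r) coef (F i) A.
Proof. exact: summxE. Qed.

Lemma imaginary_unitP J :
  imaginary_units J <-> clifford_conj J = - J /\ J * J = -1.
Proof.
split=> [[Jc JJ]|[Jc JJ]].
  have JN : clifford_conj J = - J by apply/eqP; rewrite -addr_eq0 addrC Jc.
  by split=> //; rewrite -[LHS]opprK -mulrN -JN JJ.
by split; rewrite Jc ?subrr// mulrN JJ opprK.
Qed.

Definition pure (v : 'I_n -> R) : clifford R n :=
  \sum_i v i *: clifford_gen R i.

Lemma pure_conj v : clifford_conj (pure v) = - pure v.
Proof.
rewrite /pure linear_sum -sumrN; apply: eq_bigr => i _.
by rewrite linearZ /= clifford_conj_gen scalerN.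
Qed.

(** Symmetrizing the double sum turns the products of generators into
    anticommutators, and only the diagonal ones are nonzero. *)
Lemma pure_sqr v : pure v * pure v = - (\sum_i v i ^+ 2)%:A.
Proof.
have dbl : pure v * pure v =
    \sum_i \sum_j (v i * v j) *: (clifford_gen R i * clifford_gen R j).
  rewrite /pure mulr_suml; apply: eq_bigr => i _.
  rewrite mulr_sumr; apply: eq_bigr => j _.
  by rewrite -scalerAl -scalerAr scalerA.
have two : (2 : R) *: (pure v * pure v) = (- 2 * \sum_i v i ^+ 2)%:A.
  rewrite scaler_nat mulr2n {1}dbl dbl [X in _ + X]exchange_big /= -big_split /=.
  under eq_bigr => i _.
    rewrite -big_split /=.
    under eq_bigr => j _ do
      rewrite [v j * v i]mulrC -scalerDr clifford_gen_rel scalerA.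
    rewrite (bigD1 i) //= eqxx mulr1 big1 ?addr0; last first.
      by move=> j ji; rewrite eq_sym (negPf ji) !mulr0 scale0r.
    over.
  rewrite -scaler_suml mulr_sumr; congr (_ *: _); apply: eq_bigr => i _.
  by rewrite expr2 mulrC.
have := congr1 (fun y => 2^-1 *: y) two.
rewrite /= !scalerA mulrA mulrN !mulVf// scale1r mulN1r => ->.
by rewrite scaleNr.
Qed.

Lemma pure_imaginary_unit v : \sum_i v i ^+ 2 = 1 -> imaginary_units (pure v).
Proof.
by move=> v1; apply/imaginary_unitP; rewrite pure_conj pure_sqr v1 scale1r.
Qed.

Lemma pureZ k v : k *: pure v = pure (fun i => k * v i).
Proof.
by rewrite /pure scaler_sumr; apply: eq_bigr => i _; rewrite scalerA.
Qed.

Lemma pureD v w : pure v + pure w = pure (fun i => v i + w i).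
Proof.
by rewrite /pure -big_split; apply: eq_bigr => i _ /=; rewrite -scalerDl.
Qed.

Lemma pure_gen i : pure (fun j => (j == i)%:R) = clifford_gen R i.
Proof.
rewrite /pure (bigD1 i)//= eqxx scale1r big1 ?addr0// => j /negPf ->.
by rewrite scale0r.
Qed.

Lemma gen_imaginary_unit (i : 'I_n) : imaginary_units (clifford_gen R i).
Proof.
rewrite -pure_gen; apply: pure_imaginary_unit.
by rewrite (bigD1 i)//= eqxx expr1n big1 ?addr0// => j /negPf ->; rewrite expr0n.
Qed.

Lemma imaginary_unitN J : imaginary_units J -> imaginary_units (- J).
Proof.
by move=> /imaginary_unitP[Jc JJ]; apply/imaginary_unitP; rewrite raddfN/= Jc mulrNN.
Qed.

Lemma paravectors_cone : (0 < n)%N -> paravectors R n `<=` quadratic_cone R n.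
Proof.
move=> n0 _ [x0 [v ->]]; rewrite -/(pure v).
pose s := \sum_i v i ^+ 2.
have s0 : 0 <= s by apply: sumr_ge0 => i _; exact: sqr_ge0.
have [s_eq0|s_neq0] := eqVneq s 0.
  exists (clifford_gen R (Ordinal n0)); first exact: gen_imaginary_unit.
  exists x0, 0; rewrite scale0r; congr (_ + _); rewrite /pure big1// => i _.
  have := psumr_eq0P (fun i _ => sqr_ge0 (v i)) s_eq0.
  by move=> /(_ i isT)/eqP; rewrite sqrf_eq0 => /eqP ->; rewrite scale0r.
have r0 : Num.sqrt s != 0 by rewrite sqrtr_eq0 -ltNge lt_neqAle eq_sym s_neq0.
exists ((Num.sqrt s)^-1 *: pure v); last first.
  by exists x0, (Num.sqrt s); rewrite scalerA divff// scale1r.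
rewrite pureZ; apply: pure_imaginary_unit.
under eq_bigr do rewrite exprMn.
by rewrite -mulr_sumr exprVn sqr_sqrtr// mulVf.
Qed.

Lemma gen_plane_paravector (i : 'I_n) a b :
  paravectors R n (a%:A + b *: clifford_gen R i).
Proof. by exists a, (fun j => b * (j == i)%:R); rewrite -/(pure _) -pureZ pure_gen. Qed.

Lemma clifford_inv_eq x y : x * y = 1 -> y * x = 1 -> x^-1 = y.
Proof.
move=> xy yx; have ux : x \is a GRing.unit by apply/unitrP; exists y.
by rewrite -[y](mulKr ux) xy mulr1.
Qed.

Lemma clifford_conj_cone J a b : imaginary_units J ->
  clifford_conj (a%:A + b *: J) = a%:A + b *: - J.
Proof.
move=> /imaginary_unitP[Jc _].
rewrite [LHS]linearD /= [X in X + _]linearZ [X in _ + X]linearZ /= Jc.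
by rewrite -blade_set0 clifford_conj_blade blade_sign0l scale1r.
Qed.

Lemma clifford_Im_cone J a b : imaginary_units J ->
  clifford_Im (a%:A + b *: J) = b *: J.
Proof.
move=> JI; rewrite /clifford_Im (clifford_conj_cone _ _ JI).
rewrite scalerN opprD opprK addrACA subrr add0r -scalerDl scalerA.
by congr (_ *: _); field.
Qed.

Lemma imaginary_unit_scaleV J b : imaginary_units J -> b != 0 ->
  (b *: J)^-1 = - b^-1 *: J.
Proof.
move=> /imaginary_unitP[_ JJ] b0.
by apply: clifford_inv_eq; rewrite -scalerAl -scalerAr scalerA JJ scalerN
  ?mulrN ?mulNr scaleNr opprK ?divff ?mulVf// scale1r.
Qed.

Lemma cone_not_real J a b : imaginary_units J -> b != 0 ->
  ~ real_points (a%:A + b *: J).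
Proof.
move=> /[dup] JI /imaginary_unitP[_ JJ] b0 [c ac].
have := clifford_Im_cone a b JI.
rewrite ac -[c%:A]addr0 -(scale0r J) (clifford_Im_cone _ _ JI) scale0r => bJ.
have := congr1 (fun y => y * (b^-1 *: J)) bJ.
rewrite /= mul0r -scalerAl -scalerAr scalerA divff// scale1r JJ => /esym/eqP.
by rewrite oppr_eq0 oner_eq0.
Qed.

End CliffordAlgebraFacts.

(** * Slice functions and their stem functions *)
Section SliceFunctions.
Local Open Scope complex_scope.
Local Notation Re := complex.Re.
Local Notation Im := complex.Im.
Variables (R : realType) (n : nat).
Variables (f : clifford R n -> clifford R n) (F : R[i] -> clifford R[i] n).
Hypothesis FS : stem_function F.
Hypothesis FE : entire_stem F.
Hypothesis Ff : slice_function_of F f.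
Implicit Types (x J : clifford R n) (A B : {set 'I_n}).

Lemma coef_stem1 z A : coef (stem1 F z) A = Re (coef (F z) A).
Proof. by rewrite /coef /stem1 mxE. Qed.

Lemma coef_stem2 z A : coef (stem2 F z) A = Im (coef (F z) A).
Proof. by rewrite /coef /stem2 mxE. Qed.

Lemma coef_stem_conj z A : coef (F (conjc z)) A = conjc (coef (F z) A).
Proof. by rewrite FS /coef mxE. Qed.

Lemma entire_coef A : entire (fun z => coef (F z) A).
Proof.
move=> z; apply/derivable1_diffP.
have /derivable1_diffP dF : derivable (F : R[i]^o -> clifford R[i] n) z 1.
  exact: FE.
exact: (differentiable_comp dF (differentiable_coord _ ord0 (enum_rank A))).
Qed.

(** Each coordinate of F is p + q z by the Liouville theorem, and p, q are real
    because F commutes with conjugation (at z = 0 and z = 1).  Thus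
    F (a + i b) = p + (a + i b) q, and replacing i by J gives f. *)
Lemma stem2_growth_slice_affine (C : R) :
  (forall z A, `|coef (stem2 F z) A| <= C * (1 + `|Im z|)) ->
  exists a b : clifford R n, forall x, quadratic_cone R n x -> f x = a + x * b.
Proof.
move=> FC.
have coefs A : exists pq : R * R, forall z,
    coef (F z) A = pq.1%:C + pq.2%:C * z.
  have [|p [q pqF]] := @entire_Im_linear_growth _ _ C (@entire_coef A).
    by move=> z; rewrite -coef_stem2.
  exists (Re p, Re q) => z /=; rewrite pqF.
  have := coef_stem_conj 0 A; have := coef_stem_conj 1 A.
  rewrite conjc0 conjc1 !pqF mulr0 mulr1 addr0; case: (p) (q) => [p1 p2] [q1 q2].
  move=> /(congr1 (@complex.Im R))/= h1 /(congr1 (@complex.Im R))/= h2.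
  have p20 : p2 = 0 by lra.
  have q20 : q2 = 0 by lra.
  by rewrite p20 q20.
have [pq pqP] := @choice _ _ _ coefs.
exists (\sum_A (pq A).1 *: blade R A), (\sum_A (pq A).2 *: blade R A).
have coef_lin (g : {set 'I_n} -> R) A : coef (\sum_B g B *: blade R B) A = g A.
  rewrite coef_sum (bigD1 A)//= Defs.coefZ coef_blade eqxx mulr1 big1 ?addr0// => B.
  by rewrite eq_sym Defs.coefZ coef_blade => /negPf ->; rewrite mulr0.
move=> _ [J JI [a [b ->]]]; rewrite (Ff _ _ JI) mulrDl -!scalerAl mul1r.
set p := \sum_B (pq B).1 *: _; set q := \sum_B (pq B).2 *: _.
have -> : stem1 F (a +i* b) = p + a *: q.
  apply: clifford_ext => A; rewrite coef_stem1 Defs.coefD Defs.coefZ !coef_lin.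
  by rewrite pqP /=; ring.
have -> : stem2 F (a +i* b) = b *: q.
  apply: clifford_ext => A; rewrite coef_stem2 Defs.coefZ !coef_lin.
  by rewrite pqP /=; ring.
by rewrite -scalerAr addrA.
Qed.

(** f (a + b e) - f (a - b e) = 2 e F_2 (a + i b). *)
Lemma slice_bound_stem2 (i : 'I_n) (M : R) z A :
  (forall x, paravectors R n x -> `|f x| <= M) ->
  `|coef (stem2 F z) A| <= M.
Proof.
move=> fM; case: z => a b; pose e := clifford_gen R i.
have eI : imaginary_units e := gen_imaginary_unit R i.
have h : f (a%:A + b *: e) - f (a%:A + b *: - e) =
    2 *: (e * stem2 F (a +i* b)).
  rewrite (Ff _ _ eI) (Ff _ _ (imaginary_unitN eI)) opprD addrACA subrr add0r.
  by rewrite mulNr opprK -mulr2n scaler_nat.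
have p1 : `|f (a%:A + b *: e)| <= M by apply/fM/gen_plane_paravector.
have p2 : `|f (a%:A + b *: - e)| <= M.
  by rewrite scalerN -scaleNr; apply/fM/gen_plane_paravector.
have := norm_coef_bladeM (finset.set1 i) A (stem2 F (a +i* b)).
move=> /le_trans; apply.
have := ler_normB (f (a%:A + b *: e)) (f (a%:A + b *: - e)).
rewrite h normrZ ger0_norm// -/(clifford_gen R i) -/e; lra.
Qed.

Lemma spherical_quotient_cone J a b : imaginary_units J -> b != 0 ->
  spherical_quotient f (a%:A + b *: J) = b^-1 *: stem2 F (a +i* b).
Proof.
move=> JI b0; have /imaginary_unitP[_ JJ] := JI.
rewrite /spherical_quotient (clifford_Im_cone _ _ JI) (imaginary_unit_scaleV JI b0).
rewrite (clifford_conj_cone _ _ JI) (Ff _ _ JI) (Ff _ _ (imaginary_unitN JI)).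
rewrite opprD addrACA subrr add0r mulNr opprK -scalerAl -[_ + _]mulr2n mulrnAr.
rewrite mulrA JJ mulN1r mulNrn scalerN scaleNr opprK scalerA mulr2n scalerDr -scalerDl.
by congr (_ *: _); field.
Qed.

End SliceFunctions.

(** * Derivatives of curves in the Clifford algebra *)
Section CliffordCurves.
Variables (R : realType) (n : nat).
Implicit Types (G : R -> clifford R n) (A B : {set 'I_n}) (t : R).

Lemma is_derive_coefP G t (d : clifford R n) : is_derive t 1 G d <->
  forall A, is_derive t 1 (fun s => coef (G s) A) (coef d A).
Proof.
split=> [dG A|dG].
  have /derivable_mxP dGA : derivable G t 1 by exact: ex_derive.
  apply: DeriveDef; first exact: dGA.
  rewrite -[d](@derive_val _ _ _ _ _ _ _ dG) /coef derive_mx; last exact: ex_derive.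
  by rewrite mxE.
have dG' : derivable G t 1.
  apply/derivable_mxP => i j; rewrite (ord1 i) -(enum_valK j).
  exact: (@ex_derive _ _ _ _ _ _ _ (dG (enum_val j))).
apply: DeriveDef => //; rewrite derive_mx//; apply/rowP => j.
by rewrite mxE -(enum_valK j) (@derive_val _ _ _ _ _ _ _ (dG (enum_val j))).
Qed.

Lemma is_derive_bladeM A G t (d : clifford R n) : is_derive t 1 G d ->
  is_derive t 1 (fun s => blade R A * G s) (blade R A * d).
Proof.
move=> /is_derive_coefP dG; apply/is_derive_coefP => B.
rewrite coef_bladeM (_ : (fun s => _) =
  (fun s => blade_sign R A (symdiff A B) * coef (G s) (symdiff A B))).
  exact: is_deriveZ (dG _).
by apply/funext => s; rewrite coef_bladeM.
Qed.

Lemma is_derive_scale (k : R -> R) G t (k' : R) (d : clifford R n) :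
  is_derive t 1 k k' -> is_derive t 1 G d ->
  is_derive t 1 (fun s => k s *: G s) (k t *: d + k' *: G t).
Proof.
move=> dk /is_derive_coefP dG; apply/is_derive_coefP => B.
rewrite Defs.coefD !Defs.coefZ (_ : (fun s => _) =
  (fun s => k s * coef (G s) B)); last first.
  by apply/funext => s; rewrite Defs.coefZ.
rewrite [X in _ + X]mulrC; exact: is_deriveM dk (dG B).
Qed.

Lemma is_derive_reparam (p : R -> R) G t (p' : R) (d : clifford R n) :
  is_derive t 1 p p' -> is_derive (p t) 1 G d ->
  is_derive t 1 (fun s => G (p s)) (p' *: d).
Proof.
move=> dp /is_derive_coefP dG; apply/is_derive_coefP => B.
by rewrite Defs.coefZ mulrC; exact: (is_derive1_comp (dG B) dp).
Qed.

Lemma derive_curve (f : clifford R n -> clifford R n) (x v d : clifford R n) :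
  is_derive (0 : R) 1 (fun h => f (h *: v + x)) d -> 'D_v f x = d.
Proof.
move=> dc; rewrite -(@derive_val _ _ _ _ _ _ _ dc) /derive.
set g1 := fun h => h^-1 *: _; set g2 := fun h => h^-1 *: _.
suff -> : g1 = g2 by [].
by apply/funext => h; rewrite /g1 /g2 /= addr0 scale0r add0r [_%:A]mulr1.
Qed.

End CliffordCurves.

(** * The operator dbar in terms of the stem function *)
Section CauchyRiemann.
Local Open Scope complex_scope.
Local Notation Re := complex.Re.
Local Notation Im := complex.Im.

Lemma cauchy_riemann (R : realType) (E : R[i]^o -> R[i]^o) (a b : R) :
  entire E -> exists d1 d2 : R,
  [/\ is_derive a 1 (fun x : R => Re (E (x +i* b))) d1,
      is_derive a 1 (fun x : R => Im (E (x +i* b))) d2,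
      is_derive b 1 (fun y : R => Re (E (a +i* y))) (- d2) &
      is_derive b 1 (fun y : R => Im (E (a +i* y))) d1].
Proof.
move=> dE; pose D z := 'D_1 E z.
have dD (z : R[i]^o) : is_derive z 1 E (D z) by exact/derivableP/dE.
pose j : R[i] := 0 +i* 1.
have dj (z : R[i]^o) : is_derive z 1 (fun z => j * E z : R[i]^o) (j * D z).
  by have := @is_deriveZ _ _ _ E j z 1 _ (dD z).
have ReE z : Re (E z) = Im (j * E z) by case: (E z) => p q /=; ring.
have hor x : x +i* b = (0 +i* b) + x%:C * 1.
  by apply/eqP; rewrite eq_complex /=; apply/andP; split; apply/eqP; ring.
have ver y : a +i* y = (a +i* 0) + y%:C * j.
  by apply/eqP; rewrite eq_complex /=; apply/andP; split; apply/eqP; ring.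
exists (Re (D (a +i* b))), (Im (D (a +i* b))); split.
- have := Im_is_derive_line (0 +i* b) 1 a dj; rewrite -hor.
  rewrite (_ : (fun t => _) = (fun x => Re (E (x +i* b)))); last first.
    by apply/funext => x; rewrite -hor ReE.
  by move=> /is_derive_eq; apply; case: (D _) => p q /=; ring.
- have := Im_is_derive_line (0 +i* b) 1 a dD; rewrite -hor.
  rewrite (_ : (fun t => _) = (fun x => Im (E (x +i* b)))); last first.
    by apply/funext => x; rewrite -hor.
  by move=> /is_derive_eq; apply; case: (D _) => p q /=; ring.
- have := Im_is_derive_line (a +i* 0) j b dj; rewrite -ver.
  rewrite (_ : (fun t => _) = (fun y => Re (E (a +i* y)))); last first.
    by apply/funext => y; rewrite -ver ReE.
  by move=> /is_derive_eq; apply; case: (D _) => p q /=; ring.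
- have := Im_is_derive_line (a +i* 0) j b dD; rewrite -ver.
  rewrite (_ : (fun t => _) = (fun y => Im (E (a +i* y)))); last first.
    by apply/funext => y; rewrite -ver.
  by move=> /is_derive_eq; apply; case: (D _) => p q /=; ring.
Qed.

End CauchyRiemann.

Section Dbar.
Local Open Scope complex_scope.
Local Notation Re := complex.Re.
Local Notation Im := complex.Im.
Variables (R : realType) (n : nat).
Variables (f : clifford R n -> clifford R n) (F : R[i] -> clifford R[i] n).
Hypothesis FE : entire_stem F.
Hypothesis Ff : slice_function_of F f.
Implicit Types (x J : clifford R n) (A B : {set 'I_n}).

Lemma stem_cauchy_riemann (a b : R) : exists d1 d2 : clifford R n,
  [/\ is_derive a 1 (fun x : R => stem1 F (x +i* b)) d1,
      is_derive a 1 (fun x : R => stem2 F (x +i* b)) d2,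
      is_derive b 1 (fun y : R => stem1 F (a +i* y)) (- d2) &
      is_derive b 1 (fun y : R => stem2 F (a +i* y)) d1].
Proof.
have CR A : exists d : R * R,
  [/\ is_derive a 1 (fun x : R => coef (stem1 F (x +i* b)) A) d.1,
      is_derive a 1 (fun x : R => coef (stem2 F (x +i* b)) A) d.2,
      is_derive b 1 (fun y : R => coef (stem1 F (a +i* y)) A) (- d.2) &
      is_derive b 1 (fun y : R => coef (stem2 F (a +i* y)) A) d.1].
  have [d1 [d2 [h1 h2 h3 h4]]] := cauchy_riemann a b (@entire_coef _ _ F FE A).
  exists (d1, d2); rewrite /=.
  rewrite (_ : (fun t : R => _) = (fun t => Re (coef (F (t +i* b)) A))); last first.
    by apply/funext => t; rewrite coef_stem1.
  rewrite (_ : (fun t : R => coef (stem2 F (t +i* b)) A) =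
      (fun t => Im (coef (F (t +i* b)) A))); last first.
    by apply/funext => t; rewrite coef_stem2.
  rewrite (_ : (fun t : R => coef (stem1 F (a +i* t)) A) =
      (fun t => Re (coef (F (a +i* t)) A))); last first.
    by apply/funext => t; rewrite coef_stem1.
  rewrite (_ : (fun t : R => coef (stem2 F (a +i* t)) A) =
      (fun t => Im (coef (F (a +i* t)) A))); last first.
    by apply/funext => t; rewrite coef_stem2.
  by [].
have [d dP] := @choice _ _ _ CR.
have coef_of (g : {set 'I_n} -> R) : exists x : clifford R n, forall A, coef x A = g A.
  by exists (\row_j g (enum_val j)) => A; rewrite /coef mxE enum_rankK.
have [d1 d1E] := coef_of (fun A => (d A).1).
have [d2 d2E] := coef_of (fun A => (d A).2).
exists d1, d2; split; apply/is_derive_coefP => A; have [h1 h2 h3 h4] := dP A.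
- by rewrite d1E.
- by rewrite d2E.
- by rewrite /coef mxE -/(coef _ _) d2E.
- by rewrite d1E.
Qed.

(** Write e for the chosen generator.  The derivatives along 1 and e cancel by
    the Cauchy-Riemann equations.  For another generator e_i,
    a + b e + h e_i = a + r J with r = sqrt (b ^ 2 + h ^ 2) and the imaginary
    unit J = (b e + h e_i) / r.  As r is stationary at h = 0, only the
    derivative e_i / b of J contributes, and e_i (e_i / b) F_2 = - F_2 / b. *)
Lemma dbar_gen_plane (i0 : 'I_n) (a b : R) : 0 < b ->
  dbar f (a%:A + b *: clifford_gen R i0) =
  (1 - n%:R) *: (b^-1 *: stem2 F (a +i* b)).
Proof.
move=> b0; set e := clifford_gen R i0; set x := a%:A + _.
have eI : imaginary_units e := gen_imaginary_unit R i0.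
have [_ ee] := (imaginary_unitP e).1 eI.
have [d1 [d2 [S1a S2a S1b S2b]]] := stem_cauchy_riemann a b.
have shiftR (c : R) : is_derive (0 : R) 1 (fun h : R => h + c) 1.
  by apply: is_derive_eq; rewrite addr0.
have Dreal : 'D_1 f x = d1 + e * d2.
  apply: derive_curve.
  rewrite (_ : (fun h => _) =
      (fun h => stem1 F ((h + a) +i* b)) + (fun h => e * stem2 F ((h + a) +i* b))).
    apply: is_deriveD.
      rewrite -[d1]scale1r; apply: (is_derive_reparam (G := fun t => stem1 F (t +i* b))).
      by rewrite add0r.
    apply: is_derive_bladeM.
    rewrite -[d2]scale1r; apply: (is_derive_reparam (G := fun t => stem2 F (t +i* b))).
    by rewrite add0r.
  by apply/funext => h; rewrite /x addrA -scalerDl (Ff _ _ eI).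
have De : 'D_e f x = - d2 + e * d1.
  apply: derive_curve.
  rewrite (_ : (fun h => _) =
      (fun h => stem1 F (a +i* (h + b))) + (fun h => e * stem2 F (a +i* (h + b)))).
    apply: is_deriveD.
      rewrite -[- d2]scale1r.
      apply: (is_derive_reparam (G := fun t => stem1 F (a +i* t))).
      by rewrite add0r.
    apply: is_derive_bladeM.
    rewrite -[d1]scale1r; apply: (is_derive_reparam (G := fun t => stem2 F (a +i* t))).
    by rewrite add0r.
  by apply/funext => h; rewrite /x addrCA -scalerDl (Ff _ _ eI).
have Dother i : i != i0 ->
    'D_(clifford_gen R i) f x = clifford_gen R i * (b^-1 *: stem2 F (a +i* b)).
  move=> ii0; set ei := clifford_gen R i.
  pose r (h : R) := Num.sqrt (b ^+ 2 + h ^+ 2).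
  have r0 : r 0 = b by rewrite /r expr0n addr0 sqrtr_sqr gtr0_norm.
  have rh h : 0 < b ^+ 2 + h ^+ 2.
    by rewrite ltr_pwDl ?sqr_ge0// exprn_gt0.
  have dr : is_derive (0 : R) 1 r 0.
    have dq := is_deriveD (is_derive_cst (b ^+ 2 : R) (0 : R) 1)
      (is_deriveM (is_derive_id (0 : R) 1) (is_derive_id (0 : R) 1)).
    have dsq := @is_derive1_comp _ Num.sqrt (cst (b ^+ 2) + id * id) 0 _ _
      (is_derive1_sqrt (rh 0)) dq.
    apply: (is_derive_eq dsq).
    by rewrite !scale0r !addr0 mulr0.
  pose G t := t^-1 *: stem2 F (a +i* t).
  have [g dG] : exists g, is_derive b 1 G g.
    have dV : is_derive b 1 (fun t : R => t^-1) ('D_1 (fun t : R => t^-1) b).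
      by apply/derivableP; apply: (@derivableV _ _ id); rewrite ?gt_eqF.
    by eexists; exact: is_derive_scale dV S2b.
  have dGr : is_derive (0 : R) 1 (fun h => G (r h)) 0.
    by rewrite -(scale0r g); apply: is_derive_reparam; rewrite ?r0.
  have dS1 : is_derive (0 : R) 1 (fun h => stem1 F (a +i* r h)) 0.
    rewrite -(scale0r (- d2)).
    by apply: (is_derive_reparam (G := fun t => stem1 F (a +i* t))); rewrite ?r0.
  have [_ eiei] := (imaginary_unitP ei).1 (gen_imaginary_unit R i).
  have eie : ei * e = - (e * ei).
    apply/eqP; rewrite -addr_eq0; apply/eqP.
    by rewrite clifford_gen_rel (negPf ii0) mulr0 scale0r.
  apply: derive_curve.
  rewrite (_ : (fun h => _) = (fun h => stem1 F (a +i* r h)) +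
      ((fun h => e * (b *: G (r h))) + (fun h => ei * (h *: G (r h))))).
    have de := is_derive_bladeM (finset.set1 i0) (is_deriveZ b dGr).
    have dei := is_derive_bladeM (finset.set1 i)
      (is_derive_scale (is_derive_id (0 : R) 1) dGr).
    apply: (is_derive_eq (is_deriveD dS1 (is_deriveD de dei))).
    by rewrite !scaler0 scale1r mulr0 !add0r r0.
  apply/funext => h.
  have rh0 : r h != 0 by rewrite gt_eqF// sqrtr_gt0.
  pose J := (r h)^-1 *: (b *: e + h *: ei).
  have JI : imaginary_units J.
    apply/imaginary_unitP; split.
      rewrite /J linearZ /= linearD /= !linearZ /= !clifford_conj_gen.
      by rewrite !scalerN -opprD scalerN.
    have sq : (b *: e + h *: ei) * (b *: e + h *: ei) = - (b ^+ 2 + h ^+ 2)%:A.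
      rewrite mulrDl !mulrDr -!scalerAl -!scalerAr !scalerA ee eiei eie.
      rewrite (mulrC h b) !scalerN addrA addrK.
      by rewrite -opprD -scalerDl !expr2.
    rewrite /J -scalerAl -scalerAr scalerA sq.
    rewrite scalerN scalerA -invfM -expr2 sqr_sqrtr ?ltW//.
    by rewrite mulVf ?scale1r// gt_eqF.
  have -> : h *: ei + x = a%:A + r h *: J.
    by rewrite scalerA divff// scale1r /x addrCA [h *: ei + _]addrC.
  transitivity (stem1 F (a +i* r h) +
      (e * (b *: G (r h)) + ei * (h *: G (r h)))); last by [].
  rewrite (Ff _ _ JI) /J /G -scalerAl mulrDl -!scalerAl -!scalerAr scalerDr.
  by rewrite !scalerA ![_ * (r h)^-1]mulrC.
rewrite /dbar Dreal (bigD1 i0)//= -/e De.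
under eq_bigr => i ii0.
  rewrite Dother// mulrA.
  have [_ ->] := (imaginary_unitP _).1 (gen_imaginary_unit R i).
  rewrite mulN1r; over.
rewrite sumr_const cardC1 card_ord mulrDr mulrN mulrA ee mulN1r.
set X := b^-1 *: _.
rewrite addrA -opprD [e * d2 + d1]addrC subrr add0r.
have -> : 1 - n%:R = - n.-1%:R :> R.
  have n0 : (0 < n)%N by rewrite (leq_ltn_trans _ (ltn_ord i0)).
  by rewrite -[in LHS](prednK n0) -natr1 opprD addrCA subrr addr0.
by rewrite mulNrn scaleNr scaler_nat.
Qed.

End Dbar.

(** * Affine functions on the cone *)
Section SliceAffine.
Variables (R : realType) (n : nat) (f : clifford R n -> clifford R n).
Variables a b : clifford R n.
Hypothesis n0 : (0 < n)%N.
Hypothesis fE : forall x, quadratic_cone R n x -> f x = a + x * b.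

Lemma dbar_affine x : paravectors R n x ->
  dbar f x = b + \sum_i clifford_gen R i * (clifford_gen R i * b).
Proof.
move=> Px.
have dir v : (forall h : R, paravectors R n (h *: v + x)) -> 'D_v f x = v * b.
  move=> Pv; apply: derive_curve.
  have fl h : f (h *: v + x) = h *: (v * b) + (a + x * b).
    by rewrite (fE (paravectors_cone n0 (Pv h))) mulrDl -scalerAl addrCA.
  rewrite (_ : (fun h => _) =
      (fun h => h *: (v * b)) + cst (a + x * b)); last exact/funext.
  have dv := is_deriveD
    (is_derive_scale (is_derive_id (0 : R) 1) (is_derive_cst (v * b) (0 : R) 1))
    (is_derive_cst (a + x * b) (0 : R) 1).
  by apply: (is_derive_eq dv); rewrite scaler0 add0r addr0 scale1r.
rewrite /dbar dir ?mul1r; last first.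
  case: Px => x0 [v ->] h; exists (h + x0), v.
  by rewrite addrA -scalerDl.
congr (_ + _); apply: eq_bigr => i _; rewrite dir// => h.
case: Px => x0 [v ->]; exists x0, (fun j => h * (j == i)%:R + v j).
by rewrite -/(pure _) -/(pure _) -pureD -pureZ pure_gen addrCA.
Qed.

Lemma spherical_quotient_affine x :
  quadratic_cone R n x -> ~ real_points x -> spherical_quotient f x = b.
Proof.
move=> Cx; have Cxc : quadratic_cone R n (clifford_conj x).
  case: Cx => J JI [c [d ->]]; rewrite clifford_conj_cone//.
  by exists (- J); [exact: imaginary_unitN|exists c, d].
rewrite /spherical_quotient (fE Cx) (fE Cxc) opprD addrACA subrr add0r -mulrBl.
case: Cx => J JI [c [d ->]] xr.
have d0 : d != 0.
  by apply/eqP => d0; apply: xr; exists c; rewrite d0 scale0r addr0.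
have -> : c%:A + d *: J - clifford_conj (c%:A + d *: J) =
    2 *: clifford_Im (c%:A + d *: J).
  by rewrite /clifford_Im scalerA divff// scale1r.
rewrite (clifford_Im_cone _ _ JI) (imaginary_unit_scaleV JI d0).
rewrite -!scalerAl -!scalerAr !scalerA.
have [_ JJ] := (imaginary_unitP J).1 JI.
rewrite [J * (J * b)]mulrA JJ mulN1r scalerN -scaleNr -[RHS]scale1r; congr (_ *: _).
by field.
Qed.

(** Real points are limits of nonreal points of the cone, so that limits along
    the cone without the real points are unique there. *)
Lemma proper_within_nonreal_cone x : real_points x ->
  ProperFilter (within (quadratic_cone R n `\` @real_points R n) (nbhs x)).
Proof.
move=> [c ->]; apply: Build_ProperFilter_ex => P /nbhs_ballP[r /= r0 rP].
have eI := gen_imaginary_unit R (Ordinal n0).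
set e := clifford_gen R (Ordinal n0) in eI *.
pose t := r / 2 / (`|e| + 1).
have e1 : 0 < `|e| + 1 by rewrite ltr_wpDl.
have t0 : 0 < t by rewrite !divr_gt0.
exists (c%:A + t *: e); apply: rP; last first.
  split; first by exists e => //; exists c, t.
  by apply: cone_not_real; rewrite ?gt_eqF.
rewrite -ball_normE /ball_/= opprD addrA subrr sub0r normrN normrZ gtr0_norm//.
apply: (@le_lt_trans _ _ (r / 2)); last by lra.
by rewrite /t mulrAC ler_pdivrMr// ler_pM2l ?divr_gt0// lerDl.
Qed.

Lemma spherical_derivative_affine x :
  quadratic_cone R n x -> spherical_derivative f x = b.
Proof.
move=> Cx; rewrite /spherical_derivative; case: ifPn => [/asboolP rx|/asboolP rx].
  have PF := proper_within_nonreal_cone rx.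
  apply: cvg_lim; first exact: norm_hausdorff.
  apply: (@cvg_trans _ (cst b @
    within (quadratic_cone R n `\` @real_points R n) (nbhs x))).
    apply: near_eq_cvg; near=> y.
    have [Cy ry] : (quadratic_cone R n `\` @real_points R n) y.
      by near: y; exact: withinT.
    by rewrite spherical_quotient_affine.
  exact: cvg_cst.
exact: spherical_quotient_affine.
Unshelve. all: by end_near. Qed.

End SliceAffine.

(** * Boundedness on the paravectors *)
Lemma boundedP (R : realType) (T : Type) (V : normedModType R) (g : T -> V)
    (P : set T) :
  [bounded g x | x in P] <-> exists2 M, 0 < M & forall x, P x -> `|g x| <= M.
Proof.
split=> [[M [_ gM]]|[M M0 gM]].
  exists (`|M| + 1); first by rewrite ltr_wpDl.
  by apply: gM; rewrite (le_lt_trans (ler_norm M))// ltrDl.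
exists M; split; first exact: num_real.
by move=> N MN x /gM/le_trans; apply; exact: ltW.
Qed.

Section BoundedSliceRegular.
Local Open Scope complex_scope.
Local Notation Re := complex.Re.
Local Notation Im := complex.Im.
Variables (R : realType) (n : nat).
Variables (f : clifford R n -> clifford R n) (F : R[i] -> clifford R[i] n).
Hypothesis n0 : (0 < n)%N.
Hypothesis FS : stem_function F.
Hypothesis FE : entire_stem F.
Hypothesis Ff : slice_function_of F f.

Let i0 : 'I_n := Ordinal n0.

(** F_2 is odd in the imaginary part of its argument, so the upper half plane
    decides, and F_2 vanishes on the real axis. *)
Lemma stem2_quotient_bounded_affine (M : R) : 0 < M ->
  (forall c d : R, 0 < d -> `|d^-1 *: stem2 F (c +i* d)| <= M) ->
  exists a b : clifford R n,
    forall x, quadratic_cone R n x -> f x = a + x * b.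
Proof.
move=> M0 FM; apply: (stem2_growth_slice_affine FS FE Ff (C := M)).
have odd2 z A : coef (stem2 F (conjc z)) A = - coef (stem2 F z) A.
  by rewrite !coef_stem2 (coef_stem_conj FS); case: (coef _ _).
have pos (c d : R) A : 0 < d -> `|coef (stem2 F (c +i* d)) A| <= M * d.
  move=> d0; have := norm_coef (d^-1 *: stem2 F (c +i* d)) A.
  move=> /le_trans/(_ (FM c d d0)); rewrite Defs.coefZ normrM.
  by rewrite gtr0_norm ?invr_gt0// mulrC ler_pdivrMr.
have grow (c d : R) A : `|coef (stem2 F (c +i* d)) A| <= M * `|d|.
  have [d0|d0|d0] := ltgtP d 0.
  - have := pos c (- d) A; rewrite oppr_gt0 (ltr0_norm d0) => /(_ d0).
    by have := odd2 (c +i* d) A; rewrite /= => ->; rewrite normrN.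
  - by rewrite (gtr0_norm d0) pos.
  - have := odd2 (c +i* d) A; rewrite /= d0 oppr0 => h.
    have -> : coef (stem2 F (c +i* 0)) A = 0 by lra.
    by rewrite !normr0 mulr0.
move=> [c d] A; apply: (le_trans (grow c d A)) => /=.
by rewrite ler_pM2l// lerDr.
Qed.

Lemma spherical_derivative_bounded_affine :
  [bounded spherical_derivative f x | x in paravectors R n] ->
  exists a b : clifford R n,
    forall x, quadratic_cone R n x -> f x = a + x * b.
Proof.
move=> /boundedP[M M0 fM].
apply: (stem2_quotient_bounded_affine M0) => c d d0.
have eI := gen_imaginary_unit R i0.
have d_neq0 : d != 0 by rewrite gt_eqF.
rewrite -(spherical_quotient_cone Ff _ eI d_neq0).
have := fM _ (gen_plane_paravector i0 c d); rewrite /spherical_derivative.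
by case: ifPn => // /asboolP/(cone_not_real eI d_neq0).
Qed.

Lemma dbar_bounded_affine : (1 < n)%N ->
  [bounded dbar f x | x in paravectors R n] ->
  exists a b : clifford R n,
    forall x, quadratic_cone R n x -> f x = a + x * b.
Proof.
move=> n1 /boundedP[M M0 fM].
apply: (stem2_quotient_bounded_affine M0) => c d d0.
have := fM _ (gen_plane_paravector i0 c d); rewrite (dbar_gen_plane FE Ff)//.
rewrite normrZ => h; apply: le_trans h; rewrite ler_peMl//.
have n2 : 2 <= n%:R :> R by rewrite (ler_nat _ 2).
rewrite ler0_norm; lra.
Qed.

Lemma bounded_constant : [bounded f x | x in paravectors R n] ->
  exists a : clifford R n, forall x, quadratic_cone R n x -> f x = a.
Proof.
move=> /boundedP[M M0 fM].
have [|a [b fE]] := stem2_growth_slice_affine FS FE Ff (C := M).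
  move=> z A; apply: (le_trans (slice_bound_stem2 Ff i0 z A fM)).
  by rewrite ler_peMr// ?lerDl// ltW.
suff b0 : b = 0 by exists a => x /fE ->; rewrite b0 mulr0 addr0.
apply/eqP; rewrite -normr_le0; apply/ler_addgt0Pr => e e0; rewrite add0r.
(* |t b| <= M + |a| at the real point t, and this t makes the bound on |b| e *)
pose t := (M + `|a|) / e.
have Ma : 0 < M + `|a| by rewrite ltr_wpDr.
have t0 : 0 < t by rewrite divr_gt0.
have Pt : paravectors R n t%:A.
  by have := gen_plane_paravector i0 t 0; rewrite scale0r addr0.
have := fM _ Pt; rewrite (fE _ (paravectors_cone n0 Pt)) -scalerAl mul1r => h.
have : `|t *: b| <= M + `|a|.
  rewrite -[t *: b](addKr a) (le_trans (ler_normD _ _))// normrN addrC.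
  by rewrite lerD2r.
by rewrite normrZ gtr0_norm// -ler_pdivlMl// /t invf_div mulrVK// unitfE gt_eqF.
Qed.

End BoundedSliceRegular.

Theorem corollary4p5 (R : realType) (n : nat) (n_ge3 : (3 <= n)%N)
    (n_odd : odd n) (f : clifford R n -> clifford R n)
    (f_reg : entire_slice_regular f) :
  [/\ [bounded f x | x in paravectors R n] ->
        exists a : clifford R n,
          forall x, quadratic_cone R n x -> f x = a,
      [bounded spherical_derivative f x | x in paravectors R n] <->
        [bounded dbar f x | x in paravectors R n]
    & [bounded spherical_derivative f x | x in paravectors R n] ->
        exists a b : clifford R n,
          forall x, quadratic_cone R n x -> f x = a + x * b].
Proof.
have n0 : (0 < n)%N by exact: leq_trans n_ge3.
have n1 : (1 < n)%N by exact: leq_trans n_ge3.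
case: f_reg => F [FS FE Ff].
have sph_affine := spherical_derivative_bounded_affine n0 FS FE Ff.
have db_affine := dbar_bounded_affine n0 FS FE Ff n1.
split; [exact: bounded_constant n0 FS FE Ff| |exact: sph_affine].
split=> [/sph_affine|/db_affine] [a [b fE]]; apply/boundedP.
- exists (`|b + \sum_i clifford_gen R i * (clifford_gen R i * b)| + 1).
    by rewrite ltr_wpDl.
  by move=> x Px; rewrite (dbar_affine n0 fE Px) lerDl.
- exists (`|b| + 1); first by rewrite ltr_wpDl.
  move=> x Px; rewrite (spherical_derivative_affine n0 fE) ?lerDl//.
  exact: paravectors_cone.
Qed.
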